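(* Let $\lambda\in B(0,1)\setminus\mathbb R$, and let $f_0(z)=2z+z^2$ and $f_1(z)=\lambda\dfrac{z}{(z+1)^2}$, viewed as rational maps of the Riemann sphere $\widehat{\mathbb C}$. Consider the iterated function system $\langle f_0,f_1\rangle$ with probabilities $p_0,p_1\in(0,1)$, $p_0+p_1=1$. Assume that $$p_0\ln 2+p_1\ln|\lambda|>0\qquad\text{and}\qquad p_0>\tfrac12.$$ Then the delta measure $\delta_0$ is the only stationary probability measure. Moreover, for any $\varepsilon>0$ and for Lebesgue almost every $z\in\widehat{\mathbb C}$, the following hold for $\nu_{p_0,p_1}$-almost all $\omega\in\Sigma$: (1) $f^n_\omega(z)\notin B(0,\varepsilon)$ for infinitely many $n$; (2) $\lim_{N\to\infty}\frac1N\left|\{0\le n<N : f^n_\omega(z)\in B(0,\varepsilon)\}\right|=1$.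
   Context: $B(0,\varepsilon)=\{z\in\mathbb C:|z|<\varepsilon\}$. In the iterated function system, at each step $f_0$ or $f_1$ is chosen at random, i.i.d., with probabilities $p_0$, $p_1$. A Borel measure $m$ on $\widehat{\mathbb C}$ is stationary if $m=p_0\,f_0m+p_1\,f_1m$, where $f_im(A)=m(f_i^{-1}(A))$ is the push-forward. $\Sigma=\{0,1\}^{\mathbb N}$ (indices starting at $0$) carries the product topology and Borel $\sigma$-algebra, and $\nu_{p_0,p_1}$ is the Bernoulli measure on $\Sigma$ with probabilities $p_0,p_1$ of the symbols $0,1$. For $\omega=(\omega_i)_{i\ge0}\in\Sigma$, $f^n_\omega(z)=f_{\omega_{n-1}}\circ\cdots\circ f_{\omega_0}(z)$. *)

(* Defs.v *)
From HB Require Import structures.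
From mathcomp Require Import all_boot all_order all_algebra.
From mathcomp Require Import complex lra.
From mathcomp Require Import all_classical all_reals all_analysis.
From mathcomp Require Import measurable_realfun.

Set Implicit Arguments.
Unset Strict Implicit.
Unset Printing Implicit Defensive.

Import Order.TTheory GRing.Theory Num.Theory.
Import numFieldNormedType.Exports.
Local Open Scope classical_set_scope.
Local Open Scope ring_scope.
Local Open Scope complex_scope.

Notation borel T := (g_sigma_algebraType (@open T)).

(* [None] is the point at infinity. The regular-algebra copy [R[i]^o] is only
   there to let the norm topology of [R[i]] be inferred. *)
Notation sphere R := (one_point_compactification R[i]^o).

Section IteratedFunctionSystem.
Context {R : realType}.

Definition f0 (z : sphere R) : sphere R :=
  if z is Some w then Some (2 * w + w ^+ 2) else None.

(* [-1] is a pole as soon as [lam != 0], and the denominator has the larger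
   degree, so infinity is sent to 0. *)
Definition f1 (lam : R[i]) (z : sphere R) : sphere R :=
  if z is Some w then
    if w == -1 then None else Some (lam * (w / (w + 1) ^+ 2))
  else Some 0.

(* The symbols 0 and 1 are encoded as [false] and [true]. *)
Definition ifs_orbit (lam : R[i]) (w : nat -> bool) (n : nat) (z : sphere R) :
    sphere R :=
  iteri n (fun k => if w k then f1 lam else f0) z.

(* [normc] is the modulus as an element of [R], whereas [`|w|] lives in [R[i]]. *)
Definition disk (eps : R) : set (sphere R) :=
  [set Some w | w in [set w : R[i] | Normc.normc w < eps]].

Definition stationary (p0 p1 : R) (lam : R[i])
    (m : set (borel (sphere R)) -> \bar R) :=
  forall A : set (borel (sphere R)), measurable A ->
    m A = (p0%:E * pushforward m (f0 : borel (sphere R) -> borel (sphere R)) A +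
           p1%:E * pushforward m (f1 lam : borel (sphere R) -> borel (sphere R)) A)%E.

Definition delta0 : probability (borel (sphere R)) R :=
  \d_(Some 0 : borel (sphere R)).

(* Lebesgue (area) measure of the round sphere, written in the affine chart:
   stereographic projection has area density [4 / (1 + |z|^2)^2], and infinity
   is a null point. *)
Definition sphere_area (A : set (borel (sphere R))) : \bar R :=
  (\int[lebesgue_measure \x lebesgue_measure]_(v in
       [set v : R * R | A (Some (v.1 +i* v.2))])
     (4 / (1 + v.1 ^+ 2 + v.2 ^+ 2) ^+ 2)%:E)%E.

(* [cantor_space] is [nat -> bool] with the product topology. The masses of the
   cylinders determine a probability on it; see [bernoulli_exists] below for
   existence. *)
Definition is_bernoulli (p0 p1 : R) (nu : probability (borel cantor_space) R) :=
  forall (n : nat) (a : nat -> bool),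
    nu [set w | forall k, (k < n)%N -> w k = a k] =
    (\prod_(k < n) (if a k then p1 else p0))%:E.

End IteratedFunctionSystem.

(* The Bernoulli measure is the image of Lebesgue measure on [0, 1[ under the
   itinerary map [coding] of the expanding map [step]. *)
Section BernoulliExists.
Context {R : realType} (p0 p1 : R).
Hypotheses (p0_gt0 : 0 < p0) (p1_gt0 : 0 < p1) (p01 : p0 + p1 = 1).

Let cyl (n : nat) (a : nat -> bool) : set (nat -> bool) :=
  [set w | forall k, (k < n)%N -> w k = a k].

Let open_cyl (U : set cantor_space) (w : cantor_space) :
  open U -> U w -> exists n, cyl n w `<=` U.
Proof.
move=> oU Uw; apply: contrapT => /forallNP nU.
have {nU} /choice[v vP] : forall n, exists v : cantor_space, cyl n w v /\ ~ U v.
  by move=> n; have /existsNP[v /not_implyP[? ?]] := nU n; exists v.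
suff /(_ U) : v @ \oo --> (w : cantor_space).
  have nUw : nbhs (w : cantor_space) U by exact: open_nbhs_nbhs.
  by move=> /(_ nUw)[N _ /(_ N (leqnn N))]; exact: (vP N).2.
apply/cvg_sup => i; apply/cvg_image.
  by rewrite eqEsubset; split=> // b _; exists (fun=> b).
move=> B /= Bw; exists [set u : cantor_space | B (u i)].
  exists i.+1 => // n /= ltin; rewrite (vP n).1//.
  exact: nbhs_singleton Bw.
rewrite eqEsubset; split => [b [u Bu <-]//|b Bb].
by exists (fun=> b).
Qed.

Let step (x : R) : R := if x < p0 then x / p0 else (x - p0) / p1.
Let coding (x : R) : nat -> bool := fun n => p0 <= iter n step x.

Let measurable_step : measurable_fun setT step.
Proof.
apply: measurable_fun_if => //.
- exact: measurable_fun_ltr.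
- by apply: measurable_funM => //; exact: measurable_funTS.
- by apply: measurable_funM => //; apply: measurable_funTS; exact: measurable_funB.
Qed.

Let coding_cylE n (a : nat -> bool) : exists l : R, [/\ 0 <= l,
    l + \prod_(k < n) (if a k then p1 else p0) <= 1 &
    [set x : R | 0 <= x < 1 /\ cyl n a (coding x)] =
    `[l, l + \prod_(k < n) (if a k then p1 else p0)[%classic].
Proof.
elim: n a => [|n IH] a.
  exists 0; rewrite big_ord0 add0r lexx; split=> //.
  by apply/seteqP; split => x /=; rewrite in_itv/=; [case|split].
have [l []] := IH (fun k => a k.+1).
rewrite big_ord_recl /=.
set q := \prod_(i < n) _.
move=> l0 lq1 /seteqP[IH1 IH2].
have q_gt0 : 0 < q by apply: prodr_gt0 => i _; case: ifP.
have cylS x : cyl n.+1 a (coding x) <->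
    (p0 <= x) = a 0%N /\ cyl n (fun k => a k.+1) (coding (step x)).
  split=> [H|[H0 H] [|k]]; first split=> [|k kn].
  - exact: (H 0%N).
  - by have := H k.+1 kn; rewrite /coding iterSr.
  - by [].
  - by rewrite ltnS => /H; rewrite /coding iterSr.
have stepE x : 0 <= x < 1 -> 0 <= step x < 1.
  rewrite /step => /andP[x0 x1]; case: ltP => xp.
    by apply/andP; split; [rewrite divr_ge0// ltW|rewrite ltr_pdivrMr// mul1r].
  apply/andP; split; first by rewrite divr_ge0// ?subr_ge0// ltW.
  by rewrite ltr_pdivrMr// mul1r ltrBlDl p01.
have E x : 0 <= x < 1 -> cyl n.+1 a (coding x) <->
    (p0 <= x) = a 0%N /\ l <= step x < l + q.
  move=> x01; rewrite cylS; split=> -[-> H]; split=> //.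
    by have := IH1 (step x); rewrite /= in_itv/=; apply; split=> //; exact: stepE.
  by have := IH2 (step x); rewrite /= in_itv/= => /(_ H)[].
have [q0 q1 q01] := And3 p0_gt0 p1_gt0 p01.
case: (a 0%N) E => E; [exists (p0 + p1 * l)|exists (p0 * l)]; split.
- by nra.
- by nra.
- apply/seteqP; split=> x /=; rewrite in_itv/=.
    move=> [x01 /(E _ x01)[px]]; rewrite /step ltNge px/=.
    by rewrite ler_pdivlMr// ltr_pdivrMr// => /andP[? ?]; apply/andP; split; nra.
  move=> /andP[lx xl].
  have x01 : 0 <= x < 1 by apply/andP; split; nra.
  have px : p0 <= x by nra.
  split=> //; apply/(E _ x01); split=> //; rewrite /step ltNge px/=.
  by rewrite ler_pdivlMr// ltr_pdivrMr//; apply/andP; split; nra.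
- by nra.
- by nra.
- apply/seteqP; split=> x /=; rewrite in_itv/=.
    move=> [x01 /(E _ x01)[px]]; rewrite /step ltNge px/=.
    by rewrite ler_pdivlMr// ltr_pdivrMr// => /andP[? ?]; apply/andP; split; nra.
  move=> /andP[lx xl].
  have x01 : 0 <= x < 1 by apply/andP; split; nra.
  have px : (p0 <= x) = false by apply/negbTE; rewrite -ltNge; nra.
  split=> //; apply/(E _ x01); split=> //; rewrite /step ltNge px/=.
  by rewrite ler_pdivlMr// ltr_pdivrMr//; apply/andP; split; nra.
Qed.

Let coding_borel (x : R) : borel cantor_space := coding x.

Let measurable_coding_cyl n a : measurable (coding_borel @^-1` cyl n a).
Proof.
rewrite (_ : _ @^-1` _ = \bigcap_(k in [set k | (k < n)%N])
    [set x | (p0 <= iter k step x) = a k]).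
  apply: bigcap_measurableType => k _.
  have mk : measurable_fun setT (fun x => p0 <= iter k step x).
    apply: measurable_fun_ler => //.
    elim: k => [|k IH]; first exact: measurable_id.
    exact: (measurableT_comp measurable_step IH).
  by have := mk measurableT [set a k] I; rewrite setTI.
by apply/seteqP; split=> x /=.
Qed.

Let measurable_coding : measurable_fun setT coding_borel.
Proof.
apply: (@measurability _ _ _ _ setT coding_borel (@open cantor_space)) => //.
move=> _ [U oU <-]; rewrite setTI.
pose a (s : seq bool) k := nth false s k.
rewrite (_ : _ @^-1` U = \bigcup_(s in [set s : seq bool | cyl (size s) (a s) `<=` U])
   (coding_borel @^-1` cyl (size s) (a s))).
  rewrite bigcup_mkcond; apply: countable_bigcupT_measurable => // s.
  by case: ifP => // _; exact: measurable_coding_cyl.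
apply/seteqP; split=> [x /= Ux|x [s /= sU]]; last exact: sU.
have [n nU] := open_cyl oU Ux.
exists (mkseq (coding x) n); rewrite /= size_mkseq.
  move=> w ww; apply: nU => k kn; rewrite ww// /a nth_mkseq//.
by move=> k kn; rewrite /a nth_mkseq.
Qed.

Let leb01 := mrestr (@lebesgue_measure R) (measurable_itv `[0, 1[).

Let leb01T : leb01 setT = 1%E.
Proof. by rewrite /leb01 /mrestr setTI lebesgue_measure_itv/= lte01 oppr0 adde0. Qed.

Lemma bernoulli_exists :
  exists nu : probability (borel cantor_space) R, is_bernoulli p0 p1 nu.
Proof.
have mX : measurable_fun (setT : set (measurableTypeR R)) coding_borel.
  exact: measurable_coding.
pose mcoding := @isMeasurableFun.Build _ _ (measurableTypeR R) _ coding_borel mX.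
pose X : {mfun measurableTypeR R >-> borel cantor_space} := HB.pack coding_borel mcoding.
pose P : probability (measurableTypeR R) R := HB.pack leb01 (Measure.on leb01)
  (Measure_isProbability.Build _ _ _ leb01 leb01T).
exists (distribution P X) => n a.
have [l [l0 l1 E]] := coding_cylE n a.
rewrite /distribution/= /pushforward /leb01 /mrestr.
rewrite (_ : _ `&` _ = [set x : R | 0 <= x < 1 /\ cyl n a (coding x)]).
  rewrite E lebesgue_measure_itv/= lte_fin ltrDl ifT.
    by rewrite -EFinB addrAC subrr add0r.
  by apply: prodr_gt0 => i _; case: ifP.
by apply/seteqP; split=> x /=; rewrite in_itv/= => -[].
Qed.
End BernoulliExists.

(* Main.v *)
Require Import Defs.
From mathcomp Require Import all_boot all_order all_algebra.
From mathcomp Require Import complex ring lra.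
From mathcomp Require Import all_classical all_reals all_analysis.

Set Implicit Arguments.
Unset Strict Implicit.
Unset Printing Implicit Defensive.

Import Order.TTheory GRing.Theory Num.Theory.
Import numFieldNormedType.Exports.
Local Open Scope classical_set_scope.
Local Open Scope ring_scope.
Local Open Scope complex_scope.

(* In the coordinate u = z + 1 the map f0 is squaring. Hence from every z <> 0 some
   word leads close to infinity: off the circle |u| = 1 iterate f0, and apply f1 at
   the end if |u| < 1; a point of the circle none of whose images leaves it would
   generate, under squaring, roots of a cubic equation, and the cubic does not have
   enough roots. By compactness the words have bounded length off any disk B
   around 0.

   Close to infinity f0^n followed by f1 lands at distance about exp(-2^n) from 0,
   and leaving B then takes about 2^n steps because f0 and f1 are 3-Lipschitz
   at 0. This scenario has probability of order p0^n and 2 p0 > 1, so the time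
   spent in B has infinite mean. For a stationary m the accounting bounds
   (2 p0)^n m(near infinity), hence m charges no neighbourhood of infinity, and so
   nothing but 0. For the random orbit it yields, for each delta > 0, a bounded U
   such that the indicator of the complement of B is at most delta + PU - U, where
   P is the averaging operator; Chernoff's bound and Borel-Cantelli give (2).

   For (1), the positive Lyapunov exponent makes |z|^(-s) a strict supermartingale
   in B for small s, so orbits leave B unless they hit 0 exactly, and each time they
   are off B they have a uniformly positive chance to come close to infinity. The
   points that can hit 0 form a countable set. *)

(** * The cubic equation of the circle *)

Section CubicRoots.
Context {F : fieldType}.
Implicit Types a b c d x y z u w l m : F.

(** Divided differences: [P x - P y] and [P y - P z], divided by [x - y] and [y - z], give [E1] and
    [E2]; the same operation on these two gives the sum of the roots. *)
Lemma vieta3 a b c d x y z :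
  let P t := a * t ^+ 3 + b * t ^+ 2 + c * t + d in
  x != y -> y != z -> z != x -> P x = 0 -> P y = 0 -> P z = 0 ->
  [/\ b = - a * (x + y + z), c = a * (x * y + y * z + z * x)
    & d = - a * (x * y * z)].
Proof.
move=> P; rewrite -subr_eq0 => xy; rewrite -subr_eq0 => yz; rewrite -subr_eq0 => zx.
move=> Px Py Pz.
have E1 : a * (x ^+ 2 + x * y + y ^+ 2) + b * (x + y) + c = 0.
  apply: (mulfI xy); rewrite mulr0 -[RHS](subrr 0) -{1}Px -Py /P; ring.
have E2 : a * (y ^+ 2 + y * z + z ^+ 2) + b * (y + z) + c = 0.
  apply: (mulfI yz); rewrite mulr0 -[RHS](subrr 0) -{1}Py -Pz /P; ring.
have Eb : a * (x + y + z) + b = 0.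
  apply: (mulfI zx); rewrite mulr0 -[RHS](subrr 0) -{1}E2 -E1; ring.
split.
- transitivity (b - (a * (x + y + z) + b)); last ring.
  by rewrite Eb subr0.
- transitivity (c - (a * (x ^+ 2 + x * y + y ^+ 2) + b * (x + y) + c) +
    (x + y) * (a * (x + y + z) + b)); last ring.
  by rewrite E1 Eb mulr0 subr0 addr0.
- transitivity (d - P x + x * (a * (x ^+ 2 + x * y + y ^+ 2) + b * (x + y) + c) -
    x * y * (a * (x + y + z) + b)); last by rewrite /P; ring.
  by rewrite Px E1 Eb !mulr0 !subr0 addr0.
Qed.

(* With [l = lam] and [m] its conjugate, these are the points of the unit
   circle that the map [u |-> 1 + l (u - 1) / u ^+ 2] sends to the unit circle. *)
Definition circle_cubic l m u : F :=
  m * u ^+ 3 + m * l * u ^+ 2 + - (m * l) * u + - l.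

(** If [u ^+ 16 != 1], then [u, u ^+ 2, u ^+ 4] and [u ^+ 2, u ^+ 4, u ^+ 8] are two triples of
    distinct roots. Both have sum [- l], so [u ^+ 8 = u] and [u ^+ 7 = 1]; this power is also the
    product [l / m] of the first triple, whence [l = m]. *)
Lemma circle_cubic_doubling l m u : l != m -> m != 0 -> 2 != 0 :> F -> u != 0 ->
  circle_cubic l m u = 0 -> circle_cubic l m (u ^+ 2) = 0 ->
  circle_cubic l m (u ^+ 4) = 0 -> circle_cubic l m (u ^+ 8) = 0 ->
  u ^+ 16 = 1.
Proof.
move=> lm m0 two0 u0 c1 c2 c4 c8; apply/eqP/contraT => u16.
have nroot k : (2 ^ k %| 16)%N -> u ^+ (2 ^ k) != 1.
  by move=> /dvdnP[q qE]; apply: contra u16 => /eqP uk; rewrite qE mulnC exprM uk expr1n.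
(* When [v ^+ 3 = 1], the middle terms of the cubic at [v] and at [v ^+ 2] cancel in the sum, which
   leaves [2 (m - l)]. This rules out coincidences inside the two triples. *)
have fixed_of_cube v : v ^+ 3 = 1 -> circle_cubic l m v = 0 ->
    circle_cubic l m (v ^+ 2) = 0 -> False.
  move=> v3 P1 P2; move/eqP: lm; apply; apply: (mulfI two0).
  apply/eqP; rewrite -subr_eq0; apply/eqP.
  transitivity (m * (v ^+ 3 - 1) + m * ((v ^+ 3) ^+ 2 - 1) +
    m * l * v * (v ^+ 3 - 1) - circle_cubic l m v - circle_cubic l m (v ^+ 2)).
    by rewrite /circle_cubic; ring.
  by rewrite P1 P2 v3; ring.
have u1 : u != 1 by have := nroot 0 isT.
have u2 : u ^+ 2 != 1 by have := nroot 1 isT.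
have u4 : u ^+ 4 != 1 by have := nroot 2 isT.
have neq1 : u != u ^+ 2.
  by apply: contra u1 => /eqP E; apply/eqP/(mulfI u0); rewrite mulr1 -expr2 -E.
have neq2 : u ^+ 2 != u ^+ 4.
  apply: contra u2 => /eqP E; apply/eqP/(mulfI (expf_neq0 2 u0)).
  by rewrite mulr1 -exprD -E.
have neq3 : u ^+ 4 != u ^+ 8.
  apply: contra u4 => /eqP E; apply/eqP/(mulfI (expf_neq0 4 u0)).
  by rewrite mulr1 -exprD -E.
have neq4 : u ^+ 4 != u.
  apply/eqP => E; apply: (fixed_of_cube u) => //.
  by apply: (mulfI u0); rewrite mulr1 -exprS E.
have neq5 : u ^+ 8 != u ^+ 2.
  apply/eqP => E; apply: (fixed_of_cube (u ^+ 2)) => //.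
    by apply: (mulfI (expf_neq0 2 u0)); rewrite mulr1 -exprM -exprD E.
  by rewrite -exprM.
have [S1 _ Q1] := vieta3 neq1 neq2 neq4 c1 c2 c4.
have [S2 _ _] := vieta3 neq2 neq3 neq5 c2 c4 c8.
have u7 : u ^+ 7 = 1.
  apply: (mulfI u0); rewrite mulr1 -exprS.
  have := S2; rewrite S1 => /(mulfI (_ : - m != 0)).
  by rewrite oppr_eq0 => /(_ m0); rewrite -addrA [RHS]addrC => /addIr.
have : l = m.
  rewrite -[l]opprK Q1.
  transitivity (m * u ^+ 7); first ring.
  by rewrite u7 mulr1.
by move/eqP; rewrite (negPf lm).
Qed.

(* [w] is the image of [u = -1], the only preimage of the fixed point [u = 1] under
   squaring other than itself. *)
Lemma circle_cubic_minus1 l m w : m != 0 -> 2 != 0 :> F -> w = 1 - l * 2 ->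
  w ^+ 2 != 1 -> w * (1 - m * 2) = 1 ->
  circle_cubic l m (-1) = 0 -> circle_cubic l m w = 0 ->
  (w ^+ 2 != -1 -> circle_cubic l m (w ^+ 2) = 0) -> w * 2 = 1.
Proof.
move=> m0 two0 wE w2 wm c1 cw cw2.
have lE : l * 2 = 1 - w by rewrite wE; ring.
have [w1 wN1] : w != 1 /\ w != -1.
  by split; apply: contra w2 => /eqP ->; rewrite ?expr1n ?sqrrN ?expr1n.
have wp1 : w + 1 != 0 by rewrite addr_eq0.
have w0 : w != 0.
  by apply: contra_eq_neq wm => ->; rewrite mul0r eq_sym oner_eq0.
apply: (mulfI wp1); rewrite mulr1.
(* If [w ^+ 2 = -1], the candidate roots [w], [w ^+ 2], [-1] are not distinct. But then
   [2 m = 1 + w], and four times the cubic at [w] is [- 2 (w + 1)], which is not zero. *)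
have [wi|wi] := eqVneq (w ^+ 2) (-1).
  have mE : m * 2 = 1 + w.
    apply: (mulfI w0); transitivity (w - w * (1 - m * 2)); first ring.
    by rewrite wm mulrDr mulr1 -expr2 wi.
  exfalso; move/eqP: wp1; apply; apply: (mulfI two0); rewrite mulr0.
  transitivity (- (4 * circle_cubic l m w)); last by rewrite cw mulr0 oppr0.
  transitivity (- ((m * 2) * 2 * (w * w ^+ 2) + (m * 2) * (l * 2) * w ^+ 2 -
     (m * 2) * (l * 2) * w - (l * 2) * 2)); last by rewrite /circle_cubic; ring.
  rewrite mE lE wi.
  transitivity (2 * (w + 1) - (w ^+ 2 + 1) * (w - 1)); last ring.
  by rewrite wi addNr mul0r subr0.
have {cw2} cw2 := cw2 wi.
have n1 : w != w ^+ 2.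
  by apply: contra w1 => /eqP E; apply/eqP/(mulfI w0); rewrite mulr1 -expr2 -E.
have n3 : -1 != w by rewrite eq_sym.
(* The roots [w], [w ^+ 2], [-1] have sum [- l]; with [l * 2 = 1 - w] this reads
   [(w + 1) (2 w - 1) = 0]. *)
have [+ _ _] := vieta3 n1 wi n3 cw cw2 c1.
rewrite mulNr -mulrN => /(mulfI m0) E.
have : l * 2 = - (w + w ^+ 2 + -1) * 2 by rewrite E.
rewrite lE => E2; apply/eqP; rewrite -subr_eq0; apply/eqP.
transitivity (1 - w - - (w + w ^+ 2 + -1) * 2); first ring.
by rewrite E2 subrr.
Qed.
End CubicRoots.

(** * Escape to infinity *)

Section Modulus.
Context {R : realType}.
Implicit Types x y u : R[i].

Lemma normc_ge0 x : 0 <= Normc.normc x.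
Proof. by case: x => a b /=; rewrite sqrtr_ge0. Qed.

Lemma normc_gt0 x : (0 < Normc.normc x) = (x != 0).
Proof.
rewrite lt_neqAle normc_ge0 andbT eq_sym; congr (~~ _).
by apply/eqP/eqP => [/Normc.eq0_normc//|->]; rewrite Normc.normc0.
Qed.

Lemma normcD_le x y : Normc.normc (x + y) <= Normc.normc x + Normc.normc y.
Proof. exact: (@le_normcD R). Qed.

Lemma normcN_eq x : Normc.normc (- x) = Normc.normc x.
Proof. exact: (@normcN R). Qed.

Lemma normcB_le x y : Normc.normc (x - y) <= Normc.normc x + Normc.normc y.
Proof. by rewrite -(normcN_eq y) normcD_le. Qed.

Lemma normcD_ge x y : Normc.normc x - Normc.normc y <= Normc.normc (x + y).
Proof. by rewrite lerBlDr -{1}(addrK y x) normcB_le. Qed.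

Lemma normcX x n : Normc.normc (x ^+ n) = Normc.normc x ^+ n.
Proof.
by elim: n => [|n IH]; rewrite ?expr0 ?Normc.normc1// !exprS Normc.normcM IH.
Qed.

Lemma normc_nat n : Normc.normc (n%:R : R[i]) = n%:R :> R.
Proof. by rewrite (@normcMn R 1) Normc.normc1. Qed.

Lemma normc1_conjc u : (Normc.normc u = 1) <-> (u * u^*%C = 1).
Proof.
case: u => a b; have ab : 0 <= a ^+ 2 + b ^+ 2 by rewrite addr_ge0 ?sqr_ge0.
have -> : (a +i* b) * (a +i* b)^*%C = (a ^+ 2 + b ^+ 2)%:C.
  by apply/eqP; rewrite eq_complex /=; apply/andP; split; apply/eqP; ring.
rewrite [LHS]/=; split=> [H|[->]]; last by rewrite sqrtr1.
by rewrite -(sqr_sqrtr ab) H expr1n.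
Qed.

Lemma exprn_unbounded (t M : R) : 1 < t -> exists n, M < t ^+ n.
Proof.
move=> t1.
have bern n : 1 + n%:R * (t - 1) <= t ^+ n.
  elim: n => [|n IH]; first by rewrite mul0r addr0 expr0.
  have := exprn_ege1 n (ltW t1); rewrite exprS -natr1.
  by have n0 : 0 <= n%:R :> R by []; nra.
have t0 : 0 < t - 1 by rewrite subr_gt0.
exists (Num.bound (M / (t - 1))); apply: lt_le_trans (bern _).
have [M0|M0] := ltP M 0; first by rewrite (lt_le_trans M0)// addr_ge0// mulr_ge0// ltW.
have := archi_boundP (divr_ge0 M0 (ltW t0)).
by rewrite ltr_pdivrMr//; lra.
Qed.

Lemma expr_small (t e : R) : 0 <= t < 1 -> 0 < e -> exists n, t ^+ n < e.
Proof.
move=> /andP[t0 t1] e0; have [->|tn0] := eqVneq t 0.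
  by exists 1%N; rewrite expr1.
have tp : 0 < t by rewrite lt_neqAle eq_sym tn0.
have [|n] := @exprn_unbounded t^-1 e^-1; first by rewrite invf_gt1.
by rewrite exprVn ltf_pV2 ?posrE ?exprn_gt0// => ?; exists n.
Qed.
End Modulus.

Definition run {T : Type} (g : bool -> T -> T) (s : seq bool) (z : T) : T :=
  foldl (fun z b => g b z) z s.

Section WordMaps.
Context {R : realType}.
Variable lam : R[i].

Definition ifs_map (b : bool) : sphere R -> sphere R := if b then f1 lam else f0.

Definition word_map : seq bool -> sphere R -> sphere R := run ifs_map.

Lemma word_map_cat s t z : word_map (s ++ t) z = word_map t (word_map s z).
Proof. by rewrite /word_map /run foldl_cat. Qed.

Lemma ifs_orbitE w n z : ifs_orbit lam w n z = word_map (mkseq w n) z.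
Proof.
elim: n => // n IH; rewrite mkseqS -cats1 word_map_cat -IH /=.
by rewrite /ifs_map; case: (w n).
Qed.

Lemma f0_shift (u : R[i]) : f0 (Some (u - 1)) = Some (u ^+ 2 - 1).
Proof. by congr Some; ring. Qed.

Lemma f1_shift (u : R[i]) : u != 0 ->
  f1 lam (Some (u - 1)) = Some (1 + lam * ((u - 1) / u ^+ 2) - 1).
Proof.
move=> u0; rewrite /f1 -subr_eq0 opprK subrK (negPf u0); congr Some.
by ring.
Qed.

Lemma f1_shift0 : f1 lam (Some (0 - 1)) = None.
Proof. by rewrite /f1 sub0r eqxx. Qed.

Lemma word_map_f0 n (u : R[i]) :
  word_map (nseq n false) (Some (u - 1)) = Some (u ^+ (2 ^ n) - 1).
Proof.
elim: n u => [|n IH] u; first by rewrite expr1.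
rewrite -[LHS]/(word_map (nseq n false) (f0 (Some (u - 1)))) f0_shift IH.
by rewrite -exprM expnS.
Qed.

Definition outer (rho : R) : set (sphere R) :=
  [set z | if z is Some w then rho < Normc.normc w else True].

Lemma f1_pole (rho : R) : lam != 0 -> exists2 e : R, 0 < e &
  forall u : R[i], u != 0 -> Normc.normc u < e ->
    rho < Normc.normc (lam * ((u - 1) / u ^+ 2)).
Proof.
move=> lam0; have l0 : 0 < Normc.normc lam by rewrite normc_gt0.
(* For [|u| < 1/2] one has [|u - 1| > 1/2] and [|u|^2 < |u|], so the value exceeds
   [|lam| / (2 |u|)], which the second bound makes larger than [|rho| + 1]. *)
pose e := Num.min (1 / 2) (Normc.normc lam / (2 * (`|rho| + 1))).
exists e; first by rewrite lt_min divr_gt0//= divr_gt0// mulr_gt0// ltr_wpDl.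
move=> u u0 ue; apply: le_lt_trans (ler_norm rho) _; move: ue.
rewrite !Normc.normcM Normc.normcV normcX.
have := normcD_ge (-1) u; rewrite normcN_eq Normc.normc1 [-1 + u]addrC.
have t0 : 0 < Normc.normc u by rewrite normc_gt0.
have rho0 : 0 <= `|rho| by [].
rewrite /e; move: (`|rho|) rho0 t0 => r r0.
move: (Normc.normc u) (Normc.normc (u - 1)) => t d t0 dt.
rewrite lt_min !ltr_pdivlMr ?mulr_gt0 ?ltr_wpDl// => /andP[t2 tr].
rewrite mulrA ltr_pdivlMr ?exprn_gt0//.
apply: (@lt_le_trans _ _ (Normc.normc lam * (1 / 2))); last first.
  by rewrite ler_pM2l//; lra.
have rtt : r * t * t <= r * t.
  by rewrite ler_piMr// ?mulr_ge0 ?(ltW t0)//; move: t2; lra.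
by rewrite expr2 mulrA; apply: le_lt_trans rtt _; lra.
Qed.

Section Escape.
Variable rho : R.
Hypothesis lam_nreal : complex.Im lam != 0.

Definition escapes z := exists s, outer rho (word_map s z).

Lemma nonreal_neq0 : lam != 0.
Proof. by apply: contra lam_nreal => /eqP ->. Qed.

Lemma escapes_ifs_map b z : escapes (ifs_map b z) -> escapes z.
Proof. by case=> s sP; exists (b :: s). Qed.

Lemma escapes_out u : 1 < Normc.normc u -> escapes (Some (u - 1)).
Proof.
move=> u1; have [n un] := exprn_unbounded (rho + 1) u1.
exists (nseq n false); rewrite word_map_f0 /=.
apply: lt_le_trans (normcD_ge _ _).
rewrite normcN_eq Normc.normc1 normcX ltrBrDr (lt_le_trans un)//.
by rewrite ler_weXn2l ?ltW// ltnW// ltn_expl.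
Qed.

Lemma escapes_in u : Normc.normc u < 1 -> escapes (Some (u - 1)).
Proof.
have [->|u0] := eqVneq u 0; first by
  exists [:: true]; rewrite -[word_map _ _]/(f1 lam (Some (0 - 1))) f1_shift0.
move=> u1; have [e e0 eP] := f1_pole rho nonreal_neq0.
have [|n un] := @expr_small _ (Normc.normc u) e _ e0; first by rewrite normc_ge0.
exists (rcons (nseq n false) true).
rewrite -cats1 word_map_cat word_map_f0 -[word_map _ _]/(f1 lam (Some (_ - 1))).
set U := u ^+ _; have U0 : U != 0 by rewrite expf_neq0.
have Ue : Normc.normc U < e.
  rewrite normcX; apply: le_lt_trans un.
  by rewrite ler_wiXn2l ?normc_ge0 ?(ltW u1)// ltnW// ltn_expl.
rewrite f1_shift// /outer/= addrAC subrr add0r; exact: eP.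
Qed.

(** Since points inside and outside the circle escape, [u] and its image under [f1] both lie on it.
    There conjugation is inversion, which turns the condition on the image into a polynomial
    equation in [u], with the trivial factor [u - 1]. *)
Lemma stuck_circle u : u != 1 -> ~ escapes (Some (u - 1)) ->
  [/\ u * u^*%C = 1, circle_cubic lam lam^*%C u = 0,
      ~ escapes (Some (u ^+ 2 - 1)) &
      ~ escapes (Some (1 + lam * ((u - 1) / u ^+ 2) - 1))].
Proof.
have norm1 v : ~ escapes (Some (v - 1)) -> v * v^*%C = 1.
  move=> nv; apply/normc1_conjc/eqP; rewrite eq_le; apply/andP; split.
    by rewrite leNgt; apply/negP => /escapes_out.
  by rewrite leNgt; apply/negP => /escapes_in.
move=> u1 nu; have uu := norm1 _ nu.
have u0 : u != 0.
  by apply: contra_eq_neq uu => ->; rewrite mul0r eq_sym oner_eq0.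
have n1 : ~ escapes (Some (1 + lam * ((u - 1) / u ^+ 2) - 1)).
  by rewrite -f1_shift// => /(@escapes_ifs_map true).
split=> //; last first.
  by rewrite -f0_shift => /(@escapes_ifs_map false).
have := norm1 _ n1.
rewrite rmorphD rmorph1 !rmorphM/= rmorphB rmorph1 conjc_inv rmorphXn/=.
have -> : (u^*)%C = u^-1 by apply: (mulfI u0); rewrite uu divff.
move=> H; have u10 : u - 1 != 0 by rewrite subr_eq0.
apply: (mulfI u10).
(* With [v] the image of [u], the identity is [(u - 1) cubic = - u^2 (|v|^2 - 1)]. *)
transitivity (- u ^+ 2 * ((1 + lam * ((u - 1) / u ^+ 2)) *
    (1 + lam^*%C * ((u^-1 - 1) / u^-1 ^+ 2)) - 1)).
  by rewrite /circle_cubic; field.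
by rewrite H subrr !mulr0.
Qed.

(** The stuck points [T] other than 1 are stable under [f1], and under squaring as long as 1 is not
    reached. By [circle_cubic_doubling] repeated squaring does reach 1, hence passes through its
    other square root [-1]. So [-1] is stuck, then its image [w = 1 - 2 lam] too, and
    [circle_cubic_minus1] excludes this. *)
Lemma escapes_neq0 z : z <> Some 0 -> escapes z.
Proof.
case: z => [w|_]; last by exists [::].
rewrite -(addrK 1 w); set u := w + 1 => w0.
have u1 : u != 1 by apply/eqP => u1; apply: w0; rewrite u1 subrr.
apply: contrapT => {w0} nu; move: u u1 nu => {w} u u1 nu.
set m := lam^*%C.
have lm : lam != m.
  apply: contra lam_nreal; rewrite /m; case: lam => a b /=; simpc.
  rewrite eq_complex /= eqxx /= => /eqP bb; apply/eqP; lra.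
have m0 : m != 0 by rewrite conjc_eq0 nonreal_neq0.
have two0 : 2 != 0 :> R[i] by rewrite pnatr_eq0.
pose T (v : R[i]) := v != 1 /\ ~ escapes (Some (v - 1)).
have Tcubic v : T v -> circle_cubic lam m v = 0 by case=> v1 /(stuck_circle v1)[].
have Tconj v : T v -> v * v^*%C = 1 by case=> v1 /(stuck_circle v1)[].
have Tneq0 v : T v -> v != 0.
  by move=> /Tconj; apply: contra_eq_neq => ->; rewrite mul0r eq_sym oner_eq0.
have Tsqr v : T v -> v ^+ 2 != 1 -> T (v ^+ 2).
  by case=> v1 /(stuck_circle v1)[_ _ ? _] v2; split.
have Tf1 v : T v -> T (1 + lam * ((v - 1) / v ^+ 2)).
  move=> Tv; have [v1 /(stuck_circle v1)[_ _ _ ?]] := Tv; split=> //.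
  rewrite -subr_eq0 addrAC subrr add0r mulf_neq0 ?nonreal_neq0//.
  by rewrite mulf_neq0 ?subr_eq0// invr_neq0// expf_neq0// Tneq0.
have Tu : T u by [].
have Tsqrs v : T v -> T (-1) \/ T (v ^+ 2).
  move=> Tv; have [|] := eqVneq (v ^+ 2) 1; last by right; exact: Tsqr.
  move=> /eqP; rewrite sqrf_eq1 => /orP[|/eqP <-]; last by left.
  by case: Tv => /negPf ->.
have TN1 : T (-1).
  have [//|T2] := Tsqrs _ Tu.
  have [//|] := Tsqrs _ T2; rewrite -exprM => T4.
  have [//|] := Tsqrs _ T4; rewrite -exprM => T8.
  have [//|[+ _]] := Tsqrs _ T8; rewrite -exprM => /negP[]; apply/eqP.
  by apply: (circle_cubic_doubling lm m0 two0 (Tneq0 _ Tu)) => //; exact: Tcubic.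
have := Tf1 _ TN1; rewrite sqrrN expr1n divr1 -opprD mulrN.
set w := 1 - lam * (1 + 1) => Tw.
have wE : w * (1 - m * 2) = 1.
  rewrite -[RHS](Tconj _ Tw); congr (_ * _).
  by rewrite [RHS]rmorphB rmorph1 [in RHS]rmorphM [X in _ = _ - _ * X](conjc_nat _ 2).
have w2 : w ^+ 2 != 1.
  rewrite sqrf_eq1 (negPf (Tw.1))/=; apply/eqP => wN1.
  have l1 : lam = 1.
    apply: (mulIf two0); transitivity (1 - w); first by rewrite /w; ring.
    by rewrite wN1; ring.
  by move: lam_nreal; rewrite l1/= eqxx.
(* The outcome [w * 2 = 1] contradicts [|w| = 1]. *)
have := circle_cubic_minus1 m0 two0 (erefl : w = 1 - lam * 2) w2 wE
  (Tcubic _ TN1) (Tcubic _ Tw) (fun _ => Tcubic _ (Tsqr _ Tw w2)).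
move=> /(congr1 (@Normc.normc R)); rewrite Normc.normcM normc_nat Normc.normc1.
by rewrite (normc1_conjc w).2 ?Tconj//; lra.
Qed.
End Escape.
End WordMaps.

(** * Topology of the sphere *)

Section ComplexTopology.
Context {R : realType}.
Implicit Types (w : R[i]^o) (A : set R[i]^o).

Lemma nbhs_normcP w A : nbhs w A <->
  exists2 e : R, 0 < e & forall y : R[i], Normc.normc (w - y) < e -> A y.
Proof.
split=> [/(@nbhs_normP R[i] R[i]^o w A).1[/= [e e'] e0 eA]|[e e0 eA]].
  move: e0; rewrite ltcE/= => /andP[/eqP e'0 e0]; exists e => // y ye.
  by apply: eA; rewrite /= e'0 normc_def ltcR; case: (w - y) ye.
apply/(@nbhs_normP R[i] R[i]^o w A).2; exists (e%:C); first by rewrite /= ltcR.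
move=> y; rewrite /= normc_def => ye; apply: eA.
by move: ye; case: (w - y) => a b; rewrite ltcR.
Qed.

Lemma open_normc_lt (r : R) : open [set w : R[i]^o | Normc.normc w < r].
Proof.
rewrite openE => w /= wr; apply/nbhs_normcP.
exists (r - Normc.normc w); rewrite ?subr_gt0// => y /=.
have := normcB_le w (w - y); rewrite opprB addrC subrK; lra.
Qed.

Lemma open_normc_gt (r : R) : open [set w : R[i]^o | r < Normc.normc w].
Proof.
rewrite openE => w /= wr; apply/nbhs_normcP.
exists (Normc.normc w - r); rewrite ?subr_gt0// => y /=.
have := normcD_le (w - y) y; rewrite subrK; lra.
Qed.

Lemma closed_normc_le (r : R) : closed [set w : R[i]^o | Normc.normc w <= r].
Proof.
rewrite -[X in closed X]setCK; apply: open_closedC.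
rewrite [X in open X](_ : _ = [set w : R[i]^o | r < Normc.normc w]).
  exact: open_normc_gt.
by apply/seteqP; split=> w /=; rewrite ltNge => /negP.
Qed.

Lemma normc_le_ReIm (a b : R) : Normc.normc (a +i* b) <= `|a| + `|b|.
Proof.
rewrite [Normc.normc _]/= -(ger0_norm (addr_ge0 (normr_ge0 a) (normr_ge0 b))).
rewrite -sqrtr_sqr ler_wsqrtr// sqrrD !real_normK ?num_real// lerD2r lerDl.
by rewrite pmulrn_lge0// mulr_ge0.
Qed.

Lemma ReIm_le_normc (a b : R) :
  `|a| <= Normc.normc (a +i* b) /\ `|b| <= Normc.normc (a +i* b).
Proof.
by rewrite /= -!sqrtr_sqr; split; rewrite ler_wsqrtr// ?lerDl ?lerDr sqr_ge0.
Qed.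

(** The disk is a closed subset of the continuous image of the compact square of side [2 r]. *)
Lemma compact_normc_le (r : R) : compact [set w : R[i]^o | Normc.normc w <= r].
Proof.
pose g (p : R * R) : R[i]^o := p.1 +i* p.2.
have cg : continuous g.
  move=> [a b] A /nbhs_normcP[e e0 eA].
  have e20 : 0 < e / 2 by rewrite divr_gt0.
  exists (ball a (e / 2), ball b (e / 2)).
    by split; apply/nbhs_ballP; exists (e / 2).
  move=> [c d] [/= ac bd]; apply: eA.
  rewrite [X in Normc.normc X](_ : _ = (a - c) +i* (b - d))//.
  apply: le_lt_trans (normc_le_ReIm _ _) _.
  by move: ac bd; rewrite /ball/=; lra.
apply: (@subclosed_compact _ _ (g @` (`[- r, r] `*` `[- r, r]))).
- exact: closed_normc_le.
- apply: continuous_compact; first exact: continuous_subspaceT.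
  by apply: compact_setX; exact: segment_compact.
- move=> [a b] ab; exists (a, b) => //=.
  have [/le_trans/(_ ab) + /le_trans/(_ ab)] := ReIm_le_normc a b.
  by rewrite !ler_norml !in_itv/=.
Qed.

Lemma compact_normc_bounded (K : set R[i]^o) : compact K ->
  exists M : R, forall w, K w -> Normc.normc w <= M.
Proof.
rewrite compact_cover => /(_ nat [set: nat]
  (fun n => [set w : R[i]^o | Normc.normc w < n%:R])) [||D _ KD].
- by move=> n _; exact: open_normc_lt.
- move=> w _; exists (Num.bound (Normc.normc w)) => //=.
  by rewrite archi_boundP// normc_ge0.
exists (\sum_(n <- finmap.enum_fset D) n%:R) => w /KD[n /= nD /ltW/le_trans]; apply.
rewrite (big_rem n)//= lerDl; exact: sumr_ge0.
Qed.

Lemma nbhs_inftyP (A : set (sphere R)) : nbhs (None : sphere R) A <->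
  exists M : R, @outer R M `<=` A.
Proof.
split=> [[K [/compact_normc_bounded[M KM] _] KA]|[M MA]].
  exists M => -[w|] /= Mw; apply: KA; last by right.
  by left; exists w => // /KM; rewrite leNgt Mw.
exists [set w : R[i]^o | Normc.normc w <= M].
  by split; [exact: compact_normc_le|exact: closed_normc_le].
by move=> z [[w /= /negP wM <-]|->]; apply: MA => //=; rewrite ltNge.
Qed.

Lemma open_disk (r : R) : open (disk r).
Proof.
exact/one_point_compactification_open_some/open_normc_lt.
Qed.

Lemma open_outer (r : R) : open (@outer R r).
Proof.
rewrite openE => -[w /= wr|_]; last by apply/nbhs_inftyP; exists r.
have := @open_normc_gt r; rewrite openE => /(_ _ wr) H.
by move: H; rewrite /interior.
Qed.

End ComplexTopology.

Section Continuity.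
Context {R : realType}.
Variable lam : R[i].

Lemma continuous_f0 : continuous (@f0 R).
Proof.
case=> [w|].
  pose two : R[i]^o := 2; have FF : Filter (nbhs (w : R[i]^o)) by exact: nbhs_filter.
  have H0 : (fun z : R[i]^o => z) @ (w : R[i]^o) --> (w : R[i]^o) by exact: cvg_id.
  have H1 := @cvgM R[i] _ _ FF _ _ _ _ (@cvg_cst R[i]^o two _ _ FF) H0.
  have H2 := @cvgM R[i] _ _ FF _ _ _ _ H0 H0.
  have H : (fun z : R[i]^o => 2 * z + z ^+ 2 : R[i]^o) @ (w : R[i]^o) -->
      (2 * w + w ^+ 2 : R[i]^o) by exact: (@cvgD R[i] R[i]^o _ _ FF _ _ _ _ H1 H2).
  by move=> A /H.
move=> A /nbhs_inftyP[M MA]; apply/nbhs_inftyP; exists (2 + Num.max 1 M).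
move=> [w|] /= wM; apply: MA => //=.
have := normcD_ge w 2; rewrite (@normc_nat R 2) => H.
rewrite -[2 * w + w ^+ 2]/(2 * w + w * w) -mulrDl [2 + w]addrC Normc.normcM.
have : 1 <= Num.max 1 M by rewrite le_max lexx.
have : M <= Num.max 1 M by rewrite le_max lexx orbT.
by nra.
Qed.

(** The constant 4 comes from [|w + 1| >= |w| / 2], valid for [|w| >= 2]. *)
Lemma f1_infty_le (w : R[i]) : 2 <= Normc.normc w ->
  Normc.normc (lam * (w / (w + 1) ^+ 2)) * Normc.normc w <= 4 * Normc.normc lam.
Proof.
move=> w2; rewrite !Normc.normcM Normc.normcV normcX -!mulrA [leRHS]mulrC.
rewrite ler_wpM2l ?normc_ge0//.
have := normcD_ge w 1; rewrite Normc.normc1; move: w2.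
move: (Normc.normc w) (Normc.normc (w + 1)) => t d t2 td.
have d0 : 0 < d by lra.
by rewrite mulrCA ler_pdivrMl ?exprn_gt0// expr2; nra.
Qed.

Lemma continuous_f1 : lam != 0 -> continuous (f1 lam).
Proof.
move=> lam0; case=> [w|].
  have [wE|w1] := eqVneq w (-1).
    have fE : f1 lam (Some w) = None by rewrite /f1 wE eqxx.
    move=> A; rewrite fE => /nbhs_inftyP[M MA].
    have [e e0 eP] := f1_pole M lam0.
    apply/nbhs_normcP; exists e => // y; rewrite wE -opprD normcN_eq addrC => ye.
    apply: MA; rewrite /f1; case: eqVneq => //= y1.
    rewrite -[X in X / _](addrK 1 y); apply: eP => //.
    by rewrite addr_eq0.
  have FF : Filter (nbhs (w : R[i]^o)) by exact: nbhs_filter.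
  have H0 : (fun z : R[i]^o => z) @ (w : R[i]^o) --> (w : R[i]^o) by exact: cvg_id.
  have Hc (c : R[i]^o) := @cvg_cst R[i]^o c _ _ FF.
  have H1 := @cvgD R[i] R[i]^o _ _ FF _ _ _ _ H0 (Hc 1).
  have H2 := @cvgM R[i] _ _ FF _ _ _ _ H1 H1.
  have H3 f a := @cvgV R[i] _ _ FF f a.
  have d0 : (w + 1) * (w + 1) != 0 by rewrite mulf_neq0// addr_eq0.
  have H4 := @cvgM R[i] _ _ FF _ _ _ _ H0 (H3 _ _ d0 H2).
  have H5 := @cvgM R[i] _ _ FF _ _ _ _ (Hc lam) H4.
  have H : (fun z : R[i]^o => lam * (z / (z + 1) ^+ 2) : R[i]^o) @ (w : R[i]^o) -->
      (lam * (w / (w + 1) ^+ 2) : R[i]^o) by exact: H5.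
  have fE : f1 lam (Some w) = Some (lam * (w / (w + 1) ^+ 2)).
    by rewrite /f1 (negPf w1).
  move=> A; rewrite fE => /H /nbhs_normcP[e e0 eA].
  have w10 : 0 < Normc.normc (w + 1) by rewrite normc_gt0 addr_eq0.
  (* The second radius keeps the ball away from the pole, where the formula for [f1] changes. *)
  apply/nbhs_normcP; exists (Num.min e (Normc.normc (w + 1))).
    by rewrite lt_min e0.
  move=> y; rewrite lt_min => /andP[/eA Ay yw]; rewrite /f1/=; case: eqVneq => // y1.
  by move: yw; rewrite y1 opprK ltxx.
move=> A /nbhs_normcP[e e0 eA]; apply/nbhs_inftyP.
exists (Num.max 2 (4 * Normc.normc lam / e)) => -[w|] /=; last first.
  by move=> _; apply: eA; rewrite subrr Normc.normc0.
rewrite gt_max => /andP[w2 we]; case: eqVneq => [w1|_].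
  by move: w2; rewrite w1 normcN_eq Normc.normc1; lra.
apply: eA; rewrite sub0r normcN_eq.
have w0 : 0 < Normc.normc w by lra.
have := f1_infty_le (ltW w2); rewrite -ler_pdivlMr// => /le_lt_trans; apply.
by move: we; rewrite !ltr_pdivrMr// [ltRHS]mulrC.
Qed.

Lemma continuous_word_map s : lam != 0 -> continuous (word_map lam s).
Proof.
move=> lam0; elim: s => [|b s IH] z; first exact: cvg_id.
apply: (@continuous_comp _ _ _ (ifs_map lam b) (word_map lam s)); last exact: IH.
by case: b; [exact: continuous_f1|exact: continuous_f0].
Qed.

Lemma escapes_uniform (rho r : R) : complex.Im lam != 0 -> 0 < r ->
  exists N, forall z, ~ disk r z ->
    exists2 s, (size s <= N)%N & outer rho (word_map lam s z).
Proof.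
move=> lamI r0; have lam0 := nonreal_neq0 lamI.
have cK : compact (~` @disk R r).
  apply: subclosed_compact one_point_compactification_compact _ => //.
  exact/open_closedC/open_disk.
move: cK; rewrite compact_cover => /(_ (seq bool) [set: seq bool]
  (fun s => word_map lam s @^-1` outer rho)) [||D _ KD].
- move=> s _; apply: open_comp; last exact: open_outer.
  by move=> z _; exact: continuous_word_map.
- move=> z zr; have [|s sP] := @escapes_neq0 _ _ rho lamI z.
    by move=> z0; apply: zr; rewrite z0; exists 0 => //; rewrite /mkset Normc.normc0.
  by exists s.
exists (\sum_(s <- finmap.enum_fset D) size s)%N => z /KD[s /= sD sz]; exists s => //.
by rewrite (big_rem s)//= leq_addr.
Qed.
End Continuity.

(** * The drift inequality *)

Section Averaging.
Context {R : realType} {T : Type}.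
Variables (p0 p1 : R) (g : bool -> T -> T).
Hypotheses (p0_gt0 : 0 < p0) (p1_gt0 : 0 < p1) (p01 : p0 + p1 = 1).
Implicit Types (phi psi : T -> R) (A B D : set T).

Local Notation run := (run g).

(** The transition operator of the random walk; its [n]-th iterate averages over the words of length
    [n]. *)
Definition avg phi : T -> R :=
  fun z => p0 * phi (g false z) + p1 * phi (g true z).

Lemma le_avg phi psi z : (forall y, phi y <= psi y) -> avg phi z <= avg psi z.
Proof. by move=> le; rewrite lerD// ler_wpM2l// ltW. Qed.

Lemma avg_cst (c : R) z : avg (fun=> c) z = c.
Proof. by rewrite /avg -mulrDl p01 mul1r. Qed.

Lemma avgD phi psi z : avg (fun y => phi y + psi y) z = avg phi z + avg psi z.
Proof. by rewrite /avg; ring. Qed.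

Lemma avgZ (c : R) phi z : avg (fun y => c * phi y) z = c * avg phi z.
Proof. by rewrite /avg; ring. Qed.

Lemma avg_sum (I : Type) (r : seq I) (phi : I -> T -> R) z :
  avg (fun y => \sum_(i <- r) phi i y) z = \sum_(i <- r) avg (phi i) z.
Proof. by rewrite /avg !mulr_sumr -big_split. Qed.

Definition nnbounded phi := exists C, forall z, 0 <= phi z <= C.

Lemma nnbounded_indic A : nnbounded (\1_A).
Proof. by exists 1 => z; rewrite indicE; case: (_ \in _); rewrite ?lexx ler01. Qed.

Lemma nnboundedD phi psi :
  nnbounded phi -> nnbounded psi -> nnbounded (fun z => phi z + psi z).
Proof.
move=> [C HC] [D HD]; exists (C + D) => z.
by have := HC z; have := HD z; move=> /andP[? ?] /andP[? ?]; rewrite addr_ge0 ?lerD.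
Qed.

Lemma nnboundedZ (c : R) phi : 0 <= c -> nnbounded phi -> nnbounded (fun z => c * phi z).
Proof.
move=> c0 [C HC]; exists (c * C) => z.
by have /andP[? ?] := HC z; rewrite mulr_ge0 ?ler_wpM2l.
Qed.

Lemma nnbounded_sum (I : eqType) (r : seq I) (phi : I -> T -> R) :
  (forall i, nnbounded (phi i)) -> nnbounded (fun z => \sum_(i <- r) phi i z).
Proof.
move=> H; elim: r => [|i r IH]; first by exists 0 => z; rewrite big_nil lexx.
have [C HC] := nnboundedD (H i) IH; exists C => z; rewrite big_cons; exact: HC.
Qed.

Lemma nnbounded_avg phi : nnbounded phi -> nnbounded (avg phi).
Proof.
move=> [C HC]; exists C => z; apply/andP; split; last first.
  rewrite -[leRHS](avg_cst C z); apply: le_avg => y; by have /andP[] := HC y.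
by rewrite addr_ge0// mulr_ge0// ?(ltW p0_gt0) ?(ltW p1_gt0)//;
     have /andP[] := HC (g false z); have /andP[] := HC (g true z).
Qed.

Lemma nnbounded_iter_avg n phi : nnbounded phi -> nnbounded (iter n avg phi).
Proof. by move=> H; elim: n => //= n; exact: nnbounded_avg. Qed.

(** The single word [s] already has at least this probability. *)
Lemma iter_avg_indic_ge A s z : A (run s z) ->
  Num.min p0 p1 ^+ size s <= iter (size s) avg (\1_A) z.
Proof.
have p_ge0 : 0 <= Num.min p0 p1 by rewrite le_min !ltW.
elim: s z => [|b s IH] z /=; first by move=> /mem_set Az; rewrite indicE Az expr0.
move=> /IH le; rewrite exprS /avg.
have ge0 y : 0 <= iter (size s) avg \1_A y.
  by have [C /(_ y)/andP[]] := nnbounded_iter_avg (size s) (nnbounded_indic A).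
case: b le => le; [apply: ler_wpDl|apply: ler_wpDr].
- by rewrite mulr_ge0 ?ge0 ?ltW.
- by apply: ler_pM => //; rewrite ?exprn_ge0// ge_min lexx orbT.
- by rewrite mulr_ge0 ?ge0 ?ltW.
- by apply: ler_pM => //; rewrite ?exprn_ge0// ge_min lexx.
Qed.

(* The sets [B k] shrink to a common fixed point of the two maps and the sets
   [D n] shrink to a point which [g true] maps to it: a visit to [D n], which has
   probability about [p0 ^ n], costs [2 ^ n] steps spent in [B 0]. *)
Section Drift.
Variables (B D : nat -> set T) (N : nat).
Hypotheses (p0_gt : 1 / 2 < p0)
  (B_step : forall k b z, B k.+1 z -> B k (g b z))
  (D_jump : forall n k z, (k < 2 ^ n)%N -> D n z -> B k (g true z))
  (D_step : forall n z, D n z -> D n.+1 (g false z))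
  (BD : forall n k z, D n z -> ~ B k z)
  (reach : forall z, ~ B 0%N z -> exists2 s, (size s <= N)%N & D 0%N (run s z)).

Let indic01 A z : (\1_A z : R) = 0 \/ (\1_A z : R) = 1.
Proof. by rewrite indicE; case: (_ \in _); [right|left]. Qed.

Let indic1 A z : A z -> (\1_A z : R) = 1.
Proof. by move=> Az; rewrite indicE mem_set. Qed.

Let indic0 A z : ~ A z -> (\1_A z : R) = 0.
Proof. by move=> nAz; rewrite indicE memNset. Qed.

Let indic_ge0 A z : 0 <= (\1_A z : R).
Proof. by have [->|->] := indic01 A z. Qed.

(** By [B_step], averaging shifts the sum by one index, which loses at most the term of [B 0]; this
    is the [- 1]. From [D M] the map [g true] enters all [2 ^ M] sets at once. *)
Lemma drift_stay M z :
  \sum_(0 <= k < 2 ^ M) \1_(B k) z + p1 * 2 ^+ M * \1_(D M) z - 1 <=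
  avg (fun y => \sum_(0 <= k < 2 ^ M) \1_(B k) y) z.
Proof.
have step k : (k < 2 ^ M)%N ->
    \1_(B k.+1) z + p1 * \1_(D M) z <= avg (\1_(B k)) z.
  move=> kM; rewrite /avg; have [Dz|nD] := pselect (D M z).
    rewrite (indic0 (BD (k := k.+1) Dz)) (indic1 Dz) (indic1 (D_jump kM Dz)).
    by rewrite add0r lerDr mulr_ge0// ltW.
  rewrite (indic0 nD) mulr0 addr0; have [Bz|nB] := pselect (B k.+1 z).
    by rewrite !indic1 ?mulr1 ?p01//; exact: B_step.
  by rewrite (indic0 nB) addr_ge0// mulr_ge0// ltW.
rewrite avg_sum.
apply: (@le_trans _ _ (\sum_(0 <= k < 2 ^ M) (\1_(B k.+1) z + p1 * \1_(D M) z))).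
  rewrite big_split/= sumr_const_nat subn0 -[p1 * _ *+ _]mulr_natr natrX.
  have := @big_nat_recl _ 0 +%R (2 ^ M) 0 (fun k => \1_(B k) z : R) (leq0n _).
  rewrite big_nat_recr//=.
  by have := indic_ge0 (B (2 ^ M)%N) z; have [->|->] := indic01 (B 0%N) z; lra.
by rewrite [leLHS]big_nat [leRHS]big_nat; apply: ler_sum => k /andP[_ kM]; exact: step.
Qed.

(** A point of [D n] moves to [D n.+1] with probability at least [p0], and the weights are chosen so
    that this gain telescopes. *)
Lemma drift_double M z :
  \sum_(0 <= n < M) p0 ^+ (M - n.+1) * \1_(D n.+1) z +
    p0 ^+ M * \1_(D 0%N) z - \1_(D M) z <=
  avg (fun y => \sum_(0 <= n < M) p0 ^+ (M - n.+1) * \1_(D n.+1) y) z.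
Proof.
rewrite avg_sum.
apply: (@le_trans _ _ (\sum_(0 <= n < M) p0 ^+ (M - n) * \1_(D n) z)).
  have := @big_nat_recl _ 0 +%R M 0 (fun n => p0 ^+ (M - n) * \1_(D n) z : R) (leq0n M).
  by rewrite big_nat_recr//= subnn expr0 mul1r subn0; lra.
rewrite [leLHS]big_nat [leRHS]big_nat; apply: ler_sum => n /andP[_ nM].
rewrite avgZ -subnSK// exprSr -mulrA ler_wpM2l ?exprn_ge0 ?(ltW p0_gt0)// /avg.
have [Dz|nD] := pselect (D n z).
  by rewrite (indic1 Dz) (indic1 (D_step Dz)) lerDl mulr_ge0// ltW.
by rewrite (indic0 nD) mulr0 addr_ge0// mulr_ge0// ltW.
Qed.

(** [reward] is the expected number of visits to [D 0] up to time [N]. The increment of [potential]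
    under averaging is [reward] minus [N.+1] times the indicator of [D 0]: it exchanges visits in
    the near future for a visit now. *)
Let reward z := \sum_(0 <= j < N.+1) iter j avg (\1_(D 0%N)) z.
Let potential z :=
  \sum_(0 <= j < N.+1) \sum_(0 <= i < j) iter i avg (\1_(D 0%N)) z.

Let potentialE z : avg potential z = potential z + reward z - N.+1%:R * \1_(D 0%N) z.
Proof.
rewrite /potential avg_sum /reward -big_split/=.
rewrite mulr_natl -[in X in _ = _ - X](subn0 N.+1) -sumr_const_nat -sumrB.
apply: eq_bigr => j _; rewrite avg_sum.
have := @big_nat_recl _ 0 +%R j 0 (fun i => iter i avg (\1_(D 0%N)) z) (leq0n j).
by rewrite big_nat_recr//= => ->; rewrite addrAC subrr add0r.
Qed.

Let reward_ge z : Num.min p0 p1 ^+ N * \1_(~` B 0%N) z <= reward z.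
Proof.
have p_gt0 : 0 < Num.min p0 p1 by rewrite lt_min p0_gt0.
have iter_ge0 j y : 0 <= iter j avg \1_(D 0%N) y.
  by have [C /(_ y)/andP[]] := nnbounded_iter_avg j (nnbounded_indic (D 0%N)).
have [nB|/contrapT Bz] := pselect (~ B 0%N z); last first.
  by rewrite indic0// mulr0 /reward sumr_ge0.
have [s sN sD] := reach nB; rewrite indic1// mulr1.
rewrite /reward (bigD1_seq (size s)) ?iota_uniq ?mem_index_iota//=.
apply: ler_wpDr; first exact: sumr_ge0.
apply: le_trans (iter_avg_indic_ge sD).
by rewrite ler_wiXn2l ?ltW// gt_min -p01 ltrDl p1_gt0.
Qed.

(** In the sum of the three increments the [D M] terms cancel, the gain [delta p1 (2 p0)^M] on [D 0]
    pays for the cost [N.+1 / c] there, and what remains is [- delta] plus [reward / c], which is at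
    least 1 off [B 0]. *)
Lemma drift (delta : R) : 0 < delta -> exists U, nnbounded U /\
  forall z, \1_(~` B 0%N) z <= delta + avg U z - U z.
Proof.
move=> delta0; have c0 : 0 < Num.min p0 p1 ^+ N by rewrite exprn_gt0// lt_min p0_gt0.
set c := _ ^+ N in c0.
(* The only use of [2 p0 > 1]: the gain on [D 0] must exceed the cost. *)
have [|M MP] := @exprn_unbounded _ (2 * p0) (N.+1%:R / c / (delta * p1)).
  by move: p0_gt; lra.
move: MP; rewrite ltr_pdivrMr ?mulr_gt0// => MP.
exists (fun z => (delta * \sum_(0 <= k < 2 ^ M) \1_(B k) z +
  delta * p1 * 2 ^+ M * \sum_(0 <= n < M) p0 ^+ (M - n.+1) * \1_(D n.+1) z) +
  c^-1 * potential z).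
have d0 := ltW delta0; have q1 := ltW p1_gt0; have q0 := ltW p0_gt0.
split.
  apply: nnboundedD; first apply: nnboundedD.
  - by apply: nnboundedZ => //; apply: nnbounded_sum => k; exact: nnbounded_indic.
  - apply: nnboundedZ; first by rewrite !mulr_ge0// exprn_ge0.
    apply: nnbounded_sum => n.
    by apply: nnboundedZ; [rewrite exprn_ge0|exact: nnbounded_indic].
  - apply: nnboundedZ; first by rewrite invr_ge0 ltW.
    apply: nnbounded_sum => j; apply: nnbounded_sum => i.
    exact/nnbounded_iter_avg/nnbounded_indic.
move=> z; rewrite !avgD !avgZ potentialE.
have H1 := drift_stay M z; have H2 := drift_double M z; have H3 := reward_ge z.
rewrite -/c in H3.
have {}H3 : \1_(~` B 0%N) z <= c^-1 * reward z by rewrite ler_pdivlMl.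
have {}H1 := ler_wpM2l d0 H1.
have e0 : 0 <= delta * p1 * 2 ^+ M by rewrite !mulr_ge0// exprn_ge0.
have {}H2 := ler_wpM2l e0 H2.
have H4 : c^-1 * N.+1%:R * \1_(D 0%N) z <=
    delta * p1 * 2 ^+ M * p0 ^+ M * \1_(D 0%N) z.
  rewrite ler_wpM2r// mulrC; apply: ltW; apply: lt_le_trans MP _.
  by rewrite exprMn; lra.
move: H1 H2 H3 H4.
set psi := \sum_(0 <= k < 2 ^ M) _; set apsi := avg _ _.
set q := \sum_(0 <= n < M) _; set aq := avg _ _.
move: (\1_(D 0%N) z) (\1_(D M) z) (\1_(~` B 0%N) z) (potential z) (reward z) => x y b u v.
move: (p0 ^+ M) (2 ^+ M) c^-1 (N.+1%:R) => a t e m.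
lra.
Qed.
End Drift.
End Averaging.

(** * Large deviations and recurrence along random words *)

(** From [exp (- x) >= 1 - x] one gets [(1 - x) exp x <= 1], while [(1 - x) (1 + x + 2 x^2) = 1 +
    x^2 (1 - 2 x)] is at least 1. *)
Lemma expR_le_quadratic {R : realType} (x : R) : x <= 1 / 2 ->
  expR x <= 1 + x + 2 * x ^+ 2.
Proof.
move=> x2; have := expR_ge1Dx (- x); rewrite expRN => H.
have e0 := expR_gt0 x.
have : (1 - x) * expR x <= 1 by rewrite -ler_pdivlMr// div1r.
have : 0 <= x ^+ 2 by exact: sqr_ge0.
rewrite -[expR x <= _]subr_ge0 => s1 s2.
have x10 : 0 < 1 - x by lra.
rewrite -(pmulr_rge0 _ x10) mulrBr.
have -> : (1 - x) * (1 + x + 2 * x ^+ 2) = 1 + x ^+ 2 * (1 - 2 * x) by ring.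
have : 0 <= x ^+ 2 * (1 - 2 * x) by rewrite mulr_ge0//; lra.
lra.
Qed.

Section Words.
Context {R : realType} {T : Type}.
Variables (p0 p1 : R) (g : bool -> T -> T).
Hypotheses (p0_gt0 : 0 < p0) (p1_gt0 : 0 < p1) (p01 : p0 + p1 = 1).
Implicit Types (F G : seq bool -> R) (A B D X : set T).

Local Notation run := (run g).
Local Notation avg := (avg p0 p1 g).

(** Expectation over random words of length [n]. The recursion on the first letter matches [avg] and
    keeps the estimates finite; [bernoulli_word] links them to the Bernoulli measure. *)
Fixpoint expect (n : nat) F : R :=
  if n is m.+1 then
    p0 * expect m (fun s => F (false :: s)) + p1 * expect m (fun s => F (true :: s))
  else F [::].

Lemma le_expect n F G : (forall s, size s = n -> F s <= G s) -> expect n F <= expect n G.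
Proof.
elim: n F G => [|n IH] F G FG /=; first exact: FG.
apply: lerD; rewrite (ler_wpM2l (ltW p0_gt0), ler_wpM2l (ltW p1_gt0))//.
  by apply: IH => s sn; apply: FG; rewrite /= sn.
by apply: IH => s sn; apply: FG; rewrite /= sn.
Qed.

Lemma expectZ n (c : R) F : expect n (fun s => c * F s) = c * expect n F.
Proof. by elim: n F => [//|n IH] F /=; rewrite !IH; ring. Qed.

Lemma expect_cst n (c : R) : expect n (fun=> c) = c.
Proof. by elim: n => //= n ->; rewrite -mulrDl p01 mul1r. Qed.

Lemma eq_expect n F G : F =1 G -> expect n F = expect n G.
Proof. by move=> /funext ->. Qed.

Definition visits A (s : seq bool) (z : T) : nat :=
  (\sum_(k < size s) (run (take k s) z \in A))%N.

Lemma visits_cons A b s z : visits A (b :: s) z = ((z \in A) + visits A s (g b z))%N.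
Proof. by rewrite /visits big_ord_recl. Qed.

(* [exp (theta (visits - 2 delta n - U))] is a supermartingale for small [theta]. *)
Lemma visits_exp_moment A (U : T -> R) (delta : R) : 0 < delta -> nnbounded U ->
  (forall z, \1_A z <= delta + avg U z - U z) ->
  exists2 theta, 0 < theta & exists C, forall n z,
    expect n (fun s => expR (theta * ((visits A s z)%:R - 2 * delta * n%:R))) <= C.
Proof.
move=> d0 [C' HC'] AU.
have [C C1 HC] : exists2 C, 1 <= C & forall z, 0 <= U z <= C.
  exists (Num.max 1 C') => [|z]; first by rewrite le_max lexx.
  by have /andP[U0 UC] := HC' z; rewrite U0 le_max UC orbT.
(* The first bound gives [theta C <= 1/2], as [expR_le_quadratic] requires; the second bounds the
   quadratic term [2 theta^2 C^2] by [theta delta]. *)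
pose theta := Num.min (1 / (2 * C)) (delta / (2 * C ^+ 2)).
have C0 : 0 < C by lra.
have theta0 : 0 < theta by rewrite lt_min !divr_gt0// ?mulr_gt0 ?exprn_gt0.
have thetaC : theta * C <= 1 / 2.
  rewrite -ler_pdivlMr// (_ : 1 / 2 / C = 1 / (2 * C)); last by field; rewrite gt_eqF.
  by rewrite ge_min lexx.
have thetaC2 : 2 * theta * C ^+ 2 <= delta.
  rewrite mulrAC -ler_pdivlMl ?mulr_gt0 ?exprn_gt0// mulrC.
  by rewrite ge_min lexx orbT.
(* One step of the supermartingale: of the [2 delta], one [delta] comes from the drift inequality
   and the other absorbs the quadratic term. *)
have super z : expR (theta * (\1_A z - 2 * delta)) *
    avg (fun y => expR (- theta * U y)) z <= expR (- theta * U z).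
  have quad b : expR (theta * (U z - U (g b z))) <=
      1 + theta * (U z - U (g b z)) + theta * delta.
    have /andP[? ?] := HC z; have /andP[? ?] := HC (g b z).
    have ub : U z - U (g b z) <= C by lra.
    have lb : - C <= U z - U (g b z) by lra.
    apply: le_trans (expR_le_quadratic _) _.
      by apply: le_trans thetaC; rewrite ler_pM2l.
    rewrite lerD2l exprMn mulrA (_ : 2 * theta ^+ 2 = theta * (2 * theta)); last by ring.
    rewrite -mulrA ler_pM2l//; apply: le_trans thetaC2.
    by rewrite ler_pM2l ?mulr_gt0//; nra.
  have -> : expR (- theta * U z) =
      expR (theta * (\1_A z - 2 * delta)) *
      (expR (theta * (2 * delta - \1_A z)) * expR (- theta * U z)).
    by rewrite -!expRD; congr expR; ring.
  rewrite ler_pM2l ?expR_gt0//.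
  have -> : avg (fun y => expR (- theta * U y)) z =
      avg (fun y => expR (theta * (U z - U y))) z * expR (- theta * U z).
    rewrite /avg mulrDl -!mulrA -!expRD; congr (_ * expR _ + _ * expR _); ring.
  rewrite ler_pM2r ?expR_gt0//; apply: le_trans (expR_ge1Dx _).
  have := AU z; have := quad false; have := quad true; rewrite /avg.
  move: (expR _) (expR _) => e1 e0 /(ler_wpM2l (ltW p1_gt0)) q1 /(ler_wpM2l (ltW p0_gt0)) q0.
  move=> /(ler_wpM2l (ltW theta0)) q.
  apply: le_trans (lerD q0 q1) _.
  have pE : p1 = 1 - p0 by rewrite -p01 addrAC subrr add0r.
  move: q; rewrite pE; lra.
exists theta => //; exists (expR (theta * C)) => n z.
have main : expect n (fun s => expR (theta * ((visits A s z)%:R - 2 * delta * n%:R)) *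
    expR (- theta * U (run s z))) <= expR (- theta * U z).
  elim: n z => [|n IH] z.
    by rewrite /= /visits big_ord0 mulr0 subrr mulr0 expR0 mul1r.
  have step b : expect n (fun s => expR (theta * ((visits A (b :: s) z)%:R -
      2 * delta * n.+1%:R)) * expR (- theta * U (run (b :: s) z))) <=
      expR (theta * (\1_A z - 2 * delta)) * expR (- theta * U (g b z)).
    apply: le_trans (ler_wpM2l (expR_ge0 _) (IH (g b z))).
    rewrite -expectZ; apply: le_expect => s _.
    rewrite [leRHS]mulrA -[in leRHS]expRD visits_cons.
    by rewrite le_eqVlt; apply/orP; left; apply/eqP; congr (expR _ * _);
       rewrite natrD -natr1 indicE; ring.
  apply: le_trans (super z); rewrite /avg mulrDr ![expR _ * (_ * _)]mulrCA.
  by apply: lerD; rewrite ler_pM2l//; exact: step.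
(* As [0 <= U <= C], removing [U] costs a factor [exp (theta C)]. *)
have {}main : expect n (fun s => expR (theta * ((visits A s z)%:R - 2 * delta * n%:R)) *
    expR (- theta * C)) <= 1.
  apply: le_trans (le_trans main _).
    apply: le_expect => s _; rewrite ler_pM2l ?expR_gt0// ler_expR !mulNr lerN2.
    by rewrite ler_pM2l//; have /andP[] := HC (run s z).
  by rewrite -expR0 ler_expR mulNr oppr_le0 mulr_ge0 ?(ltW theta0)//; have /andP[] := HC z.
have := ler_wpM2l (expR_ge0 (theta * C)) main; rewrite mulr1; apply: le_trans.
rewrite -expectZ; apply: le_expect => s _.
by rewrite mulrCA -expRD mulNr subrr expR0 mulr1.
Qed.

(** Chernoff's bound: on this event the exponent in [visits_exp_moment] is at least
    [theta delta n]. *)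
Lemma visits_deviation A (U : T -> R) (delta : R) : 0 < delta -> nnbounded U ->
  (forall z, \1_A z <= delta + avg U z - U z) ->
  exists C t : R, [/\ 0 <= C, 0 <= t < 1 & forall n z,
    expect n (fun s => (3 * delta * n%:R <= (visits A s z)%:R)%R%:R) <= C * t ^+ n].
Proof.
move=> d0 bU AU; have [theta th0 [C HC]] := visits_exp_moment d0 bU AU.
have td : 0 < theta * delta by rewrite mulr_gt0.
exists `|C|, (expR (- (theta * delta))); split=> // [|n z].
  by rewrite expR_ge0 /= expR_lt1 oppr_lt0.
rewrite [leRHS]mulrC -ler_pdivrMl ?exprn_gt0 ?expR_gt0//.
apply: le_trans (le_trans (HC n z) (ler_norm C)).
rewrite -expectZ; apply: le_expect => s _.
case le: (3 * delta * n%:R <= (visits A s z)%:R); last first.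
  by rewrite mulr0 expR_ge0.
rewrite mulr1 expRN exprVn invrK -expRM_natr ler_expR -[leLHS]mulrA ler_pM2l//.
by move: le; move: ((visits A s z)%:R) (n%:R) => v m; lra.
Qed.

(** The end point of the word is tested too, whereas [visits] does not count it. *)
Fixpoint avoids A (s : seq bool) (z : T) : bool :=
  (z \notin A) && (if s is b :: s' then avoids A s' (g b z) else true).

Lemma avoidsP A s z :
  reflect (forall k, (k <= size s)%N -> ~ A (run (take k s) z)) (avoids A s z).
Proof.
apply: (iffP idP); elim: s z => [|b s IH] z /=.
- by rewrite andbT => /negP zA [|//] _ /mem_set.
- by move=> /andP[/negP zA /IH H] [_ /mem_set//|k]; exact: H.
- by move=> /(_ 0%N isT) zA; rewrite andbT memNset.
- move=> H; rewrite memNset//=; last exact: (H 0%N).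
  by apply: IH => k; exact: (H k.+1).
Qed.

Section Hitting.
Variables (B D X : set T) (V : T -> R) (rho : R) (N : nat).
Hypotheses (X_step : forall b z, X z -> X (g b z))
  (V_ge0 : forall z, 0 <= V z) (V_ge1 : forall z, X z -> B z -> 1 <= V z)
  (rho01 : 0 <= rho < 1)
  (V_step : forall z, X z -> B z -> avg V z <= rho * V z)
  (reach : forall z, ~ B z -> exists2 s, (size s <= N)%N & D (run s z)).

Let h n z := expect n (fun s => (avoids D s z)%:R).

Let h0E z : h 0 z = (z \notin D)%:R.
Proof. by rewrite /h /= andbT. Qed.

Let hSE n z : h n.+1 z = (z \notin D)%:R * avg (h n) z.
Proof.
have E b : expect n (fun s => (avoids D (b :: s) z)%:R) = (z \notin D)%:R * h n (g b z).
  by rewrite -expectZ; apply: eq_expect => s /=; rewrite -natrM mulnb.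
by rewrite {1}/h [LHS]/= !E /avg; ring.
Qed.

Let h_ge0 n z : 0 <= h n z.
Proof. by rewrite -(expect_cst n 0); apply: le_expect. Qed.

Let h_le1 n z : h n z <= 1.
Proof. by rewrite -(expect_cst n 1); apply: le_expect => s _; rewrite lern1 leq_b1. Qed.

Let hS_avg n z : h n.+1 z <= avg (h n) z.
Proof.
rewrite hSE ler_piMl// ?lern1 ?leq_b1//.
by rewrite addr_ge0// mulr_ge0// ltW.
Qed.

Let h_noninc m n z : (m <= n)%N -> h n z <= h m z.
Proof.
have S k y : h k.+1 y <= h k y.
  elim: k y => [|k IH] y; rewrite hSE.
    rewrite h0E ler_piMr//; rewrite -(avg_cst g p01 1 y); exact: le_avg.
  by rewrite hSE ler_wpM2l//; apply: le_avg.
move=> /subnKC <-; elim: (n - m)%N => [|k IH]; first by rewrite addn0.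
by rewrite addnS (le_trans (S _ _)).
Qed.

(** The probability of never meeting [D], as the limit of the nonincreasing [h n z]. *)
Let hinf z := inf [set h n z | n in [set: nat]].

Let has_inf_h z : has_inf [set h n z | n in [set: nat]].
Proof. by split; [exists (h 0 z), 0%N|exists 0 => _ [n _ <-]]. Qed.

Let hinf_le n z : hinf z <= h n z.
Proof. by apply: ge_inf; [exact: (has_inf_h z).2|exists n]. Qed.

Let hinf_ge0 z : 0 <= hinf z.
Proof. by apply: lb_le_inf; [exact: (has_inf_h z).1|move=> _ [n _ <-]]. Qed.

Let hinf_approx z e : 0 < e -> exists n, forall m, (n <= m)%N -> h m z < hinf z + e.
Proof.
move=> e0; have [_ [n _ <-] ne] := inf_adherent e0 (has_inf_h z).
by exists n => m nm; apply: le_lt_trans (h_noninc z nm) ne.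
Qed.

Let hinf_avg z : hinf z <= avg hinf z.
Proof.
apply/ler_addgt0Pr => e e0.
have [n0 n0P] := hinf_approx (g false z) e0.
have [n1 n1P] := hinf_approx (g true z) e0.
apply: le_trans (hinf_le (maxn n0 n1).+1 z) _; apply: le_trans (hS_avg _ _) _.
rewrite -[e in leRHS](avg_cst g p01 e z) -avgD /avg.
by rewrite lerD// ler_pM2l// ltW// (n0P, n1P)// (leq_maxl, leq_maxr).
Qed.

Let S := sup [set hinf z | z in X].

Let hinf_le_S z : X z -> hinf z <= S.
Proof.
move=> Xz; apply: ub_le_sup; last by exists z.
by exists 1 => _ [y _ <-]; apply: le_trans (hinf_le 0 y) (h_le1 0 y).
Qed.

(** Either the walk follows [s] and meets [D], or it branches off to a point of [X], from where [D]
    is avoided with probability at most [S]. *)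
Let hinf_word s z : X z -> D (run s z) ->
  hinf z <= (1 - Num.min p0 p1 ^+ size s) * S.
Proof.
elim: s z => [|b s IH] z Xz /= Dz.
  by rewrite expr0 subrr mul0r (le_trans (hinf_le 0 z))// h0E mem_set.
have S0 : 0 <= S by exact: le_trans (hinf_ge0 z) (hinf_le_S Xz).
have [Xf Xt] := (X_step false Xz, X_step true Xz).
have m0 : 0 <= Num.min p0 p1 by rewrite le_min !ltW.
set t := Num.min p0 p1 ^+ size s in IH.
have t0 : 0 <= t by rewrite exprn_ge0.
have mp0 : Num.min p0 p1 <= p0 by rewrite ge_min lexx.
have mp1 : Num.min p0 p1 <= p1 by rewrite ge_min lexx orbT.
rewrite exprS -/t; apply: le_trans (hinf_avg z) _.
have tm q : Num.min p0 p1 <= q -> Num.min p0 p1 * t * S <= q * t * S.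
  by move=> mq; rewrite -!mulrA ler_wpM2r// mulr_ge0.
have pE : p1 = 1 - p0 by rewrite -p01 addrAC subrr add0r.
rewrite /avg; case: b Dz => Dz.
  have := ler_wpM2l (ltW p0_gt0) (hinf_le_S Xf).
  have := ler_wpM2l (ltW p1_gt0) (IH _ Xt Dz); have := tm _ mp1; rewrite pE; lra.
have := ler_wpM2l (ltW p0_gt0) (IH _ Xf Dz).
have := ler_wpM2l (ltW p1_gt0) (hinf_le_S Xt); have := tm _ mp0; rewrite pE; lra.
Qed.

(** Off [B] the word given by [reach] yields [hinf <= (1 - c) S]. In [B] the function [V] contracts
    on average, so the walk leaves [B] and the same bound follows. Hence [S <= (1 - c) S], that is
    [S <= 0]. *)
Lemma avoids_vanish z e : X z -> 0 < e ->
  exists n, expect n (fun s => (avoids D s z)%:R) < e.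
Proof.
move=> Xz e0; suff h0 : hinf z <= 0.
  by have [n /(_ n (leqnn n)) hn] := hinf_approx z e0; exists n; rewrite -/(h n z); lra.
have m0 : 0 < Num.min p0 p1 by rewrite lt_min p0_gt0.
have m1 : Num.min p0 p1 <= 1 by rewrite ge_min -p01 lerDl ltW.
have S0 : 0 <= S by exact: le_trans (hinf_ge0 z) (hinf_le_S Xz).
pose c := Num.min p0 p1 ^+ N; have c0 : 0 < c by rewrite exprn_gt0.
have /andP[rho0 rho1] := rho01.
have outB y : X y -> ~ B y -> hinf y <= (1 - c) * S.
  move=> Xy /reach[s sN Ds]; apply: le_trans (hinf_word Xy Ds) _.
  by rewrite ler_wpM2r// lerD2l lerN2 ler_wiXn2l// ltW.
have S1 : S <= 1.
  apply: ge_sup; first by exists (hinf z), z.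
  by move=> _ [y _ <-]; apply: le_trans (hinf_le 0 y) (h_le1 0 y).
have c1 : c <= 1 by rewrite exprn_ile1// ltW.
(* The last term bounds the probability of staying in [B] during [n] steps; at [n = 0] it relies on
   [V >= 1] there. *)
have geom n y : X y -> hinf y <= (1 - c) * S + rho ^+ n * V y.
  elim: n y => [|n IH] y Xy.
    rewrite expr0 mul1r; have [By|nB] := pselect (B y).
      apply: (le_trans (hinf_le 0 y)); apply: (le_trans (h_le1 0 y)).
      by rewrite ler_wpDl ?V_ge1// mulr_ge0// subr_ge0.
    by rewrite ler_wpDr// outB.
  have [By|nB] := pselect (B y); last by rewrite ler_wpDr ?outB// mulr_ge0// exprn_ge0.
  apply: le_trans (hinf_avg y) _.
  apply: (@le_trans _ _ (avg (fun x => (1 - c) * S + rho ^+ n * V x) y)).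
    by rewrite lerD// ler_pM2l//; apply: IH; exact: X_step.
  rewrite avgD avg_cst// avgZ lerD2l exprSr -mulrA ler_wpM2l ?exprn_ge0//.
  exact: V_step.
have Sc : S <= (1 - c) * S.
  apply: ge_sup; first by exists (hinf z), z.
  move=> _ [y Xy <-]; apply/ler_addgt0Pr => d d0.
  have V1 : 0 < V y + 1 by rewrite ltr_wpDl.
  have [n rn] := expr_small rho01 (divr_gt0 d0 V1).
  apply: le_trans (geom n y Xy) _; rewrite lerD2l.
  move: rn; rewrite ltr_pdivlMr// => /ltW; apply: le_trans.
  by rewrite ler_wpM2l ?exprn_ge0// lerDl.
have : c * S <= 0 by lra.
rewrite pmulr_rle0// => S_le0; exact: le_trans (hinf_le_S Xz) S_le0.
Qed.

(** The first [M] letters only move the starting point, so the expectation is the [M]-th averaging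
    iterate of [h n]. Having it for every [M] turns one visit into infinitely many. *)
Lemma avoids_vanish_from M z e : X z -> 0 < e -> exists n,
  expect (M + n) (fun s => (avoids D (drop M s) (run (take M s) z))%:R) < e.
Proof.
move=> Xz e0; have E n : expect (M + n)
    (fun s => (avoids D (drop M s) (run (take M s) z))%:R) = iter M avg (h n) z.
  elim: M z {Xz} => [|M IH] z /=.
    by apply: eq_expect => s; rewrite drop0 take0.
  by rewrite /avg -!IH.
suff [n nP] : exists n, forall m, (n <= m)%N -> iter M avg (h m) z < e.
  by exists n; rewrite E; exact: nP.
elim: M z Xz {E} => [|M IH] z Xz.
  have [n hn] := avoids_vanish Xz e0; exists n => m nm.
  exact: le_lt_trans (h_noninc z nm) hn.
have [n0 n0P] := IH _ (X_step false Xz).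
have [n1 n1P] := IH _ (X_step true Xz).
exists (maxn n0 n1) => m; rewrite geq_max => /andP[/n0P H0 /n1P H1] /=.
by rewrite -(avg_cst g p01 e z) /avg ltrD// ltr_pM2l.
Qed.
End Hitting.
End Words.

(** * Bernoulli measures *)

Section BernoulliWords.
Context {R : realType}.
Local Notation Omega := (borel cantor_space).
Implicit Types (Q : pred (seq bool)) (a : nat -> bool).

Lemma measurable_coord k (b : bool) : measurable [set w : Omega | w k = b].
Proof.
apply: sub_sigma_algebra.
rewrite [X in open X](_ : _ = @proj nat (fun=> bool) k @^-1` [set b])//.
by apply: open_comp; [move=> w _; exact: proj_continuous|exact: discrete_open].
Qed.

Lemma measurable_coords k n a :
  measurable [set w : Omega | forall i, (i < n)%N -> w (k + i)%N = a i].
Proof.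
rewrite (_ : mkset _ = \bigcap_(i in [set i | (i < n)%N]) [set w | w (k + i)%N = a i]).
  by apply: bigcap_measurableType => i _; exact: measurable_coord.
by apply/seteqP; split=> w /=.
Qed.

Lemma measurable_word k n Q :
  measurable [set w : Omega | Q (mkseq (fun i => w (k + i)%N) n)].
Proof.
rewrite (_ : mkset _ = \bigcup_(s in [set s : seq bool | size s = n /\ Q s])
    [set w | forall i, (i < n)%N -> w (k + i)%N = nth false s i]).
  rewrite bigcup_mkcond; apply: countable_bigcupT_measurable => // s.
  by case: ifP => // _; exact: measurable_coords.
apply/seteqP; split=> [w /= Qw|w [s /= [sn Qs] ws]].
  exists (mkseq (fun i => w (k + i)%N) n); rewrite /= ?size_mkseq//.
  by move=> i ni; rewrite nth_mkseq.
rewrite (_ : mkseq _ _ = s)//; apply: (@eq_from_nth _ false); rewrite size_mkseq//.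
by move=> i ni; rewrite nth_mkseq// ws.
Qed.

Variables (p0 p1 : R) (nu : probability Omega R).
Hypothesis nuB : is_bernoulli p0 p1 nu.

(** The prescribed prefix makes the induction work: splitting on the letter [w k] moves that letter
    into the prefix, and at [n = 0] only a cylinder is left. *)
Lemma bernoulli_word_after k a n Q :
  nu ([set w : Omega | forall i, (i < k)%N -> w i = a i] `&`
      [set w : Omega | Q (mkseq (fun i => w (k + i)%N) n)]) =
  (\prod_(i < k) (if a i then p1 else p0) *
   expect p0 p1 n (fun s => (Q s)%:R))%:E.
Proof.
have mcyl m b : measurable [set w : Omega | forall i, (i < m)%N -> w i = b i].
  exact: (measurable_coords 0).
elim: n k a Q => [|n IH] k a Q.
  rewrite /=; case: (Q [::]).
    rewrite mulr1 -nuB; congr (nu _).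
    by apply/seteqP; split=> [w []|w wa].
  transitivity (nu set0); last by rewrite measure0 mulr0.
  congr (nu _).
  by apply/seteqP; split=> w // [].
pose upd b i := if i == k then b else a i.
pose ev b := [set w : Omega | forall i, (i < k.+1)%N -> w i = upd b i] `&`
  [set w : Omega | Q (b :: mkseq (fun i => w (k.+1 + i)%N) n)].
have evE b : nu (ev b) = (\prod_(i < k) (if a i then p1 else p0) *
    ((if b then p1 else p0) * expect p0 p1 n (fun s => (Q (b :: s))%:R)))%:E.
  rewrite /ev (IH _ _ (fun s => Q (b :: s))) big_ord_recr/= {2}/upd eqxx mulrA.
  congr (_ * _ * _)%:E; apply: eq_bigr => i _.
  by rewrite /upd ltn_eqF.
rewrite (_ : _ `&` _ = ev false `|` ev true).
  transitivity (nu (ev false) + nu (ev true))%E; last by rewrite !evE -EFinD -mulrDr.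
  apply: measureU.
  - by apply: measurableI; [exact: mcyl|exact: (measurable_word _ _ (fun s => Q (false :: s)))].
  - by apply: measurableI; [exact: mcyl|exact: (measurable_word _ _ (fun s => Q (true :: s)))].
  - apply/seteqP; split=> // w [[/= wf _] [/= wt _]].
    by have := wf k (ltnSn k); rewrite (wt k (ltnSn k)) /upd eqxx.
have mkE (w : nat -> bool) : mkseq (fun i => w (k + i)%N) n.+1 =
    w k :: mkseq (fun i => w (k.+1 + i)%N) n.
  rewrite /mkseq /= addn0 (iotaDl 1 0) -map_comp; congr cons.
  by apply: eq_map => i; rewrite /comp addnA addn1.
apply/seteqP; split=> [w [/= wa]|w]; rewrite ?mkE.
  move=> Qw; case wk: (w k) Qw => Qw; [right|left]; split=> //= i;
  by rewrite ltnS leq_eqVlt /upd => /orP[/eqP ->|ik]; rewrite ?eqxx ?(ltn_eqF ik)// wa.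
by case=> -[/= wa Qw]; (split=> /= [i ik|];
  [by rewrite wa ?(leqW ik)// /upd ltn_eqF
  |by rewrite mkE wa// /upd eqxx]).
Qed.

Lemma bernoulli_word n Q :
  nu [set w : Omega | Q (mkseq w n)] = (expect p0 p1 n (fun s => (Q s)%:R))%:E.
Proof.
have := bernoulli_word_after 0 (fun=> false) n Q; rewrite big_ord0 mul1r => <-.
by congr (nu _); apply/seteqP; split=> [w //= Qw|w []].
Qed.

End BernoulliWords.

(** * Dynamics near 0 and infinity *)

Lemma negligible_bigcup_count d (T : measurableType d) (R : realFieldType)
    (mu : {measure set T -> \bar R}) (I : countType) (F : I -> set T) :
  (forall i, mu.-negligible (F i)) -> mu.-negligible (\bigcup_i F i).
Proof.
move=> F0.
pose G n := if unpickle n is Some i then F i else set0.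
have : mu.-negligible (\bigcup_n G n).
  by apply: negligible_bigcup => n; rewrite /G; case: unpickle => //; exact: negligible_set0.
apply: negligibleS => x [i _ Fx]; exists (pickle i) => //.
by rewrite /G pickleK.
Qed.

Section Geometry.
Context {R : realType}.
Variables (lam : R[i]) (r sigma : R).
Hypotheses (lam_lt1 : Normc.normc lam < 1) (lam_neq0 : lam != 0).
Hypotheses (r_gt0 : 0 < r) (r_le : r <= 1 / 4).
Hypotheses (sigma_ge3 : 3 <= sigma) (sigma_r : 4 / r <= sigma).

(** [near0] and [near_infty] play the roles of [B] and [D] in the drift inequality. The ratio 3 is
    the Lipschitz constant at 0; the factor 2 in [near_infty] absorbs the loss in
    [|w + 2| >= |w| - 2]. *)
Definition near0 (k : nat) : set (sphere R) := disk (r / 3 ^+ k).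
Definition near_infty (n : nat) : set (sphere R) := outer (2 * sigma ^+ (2 ^ n)).

Lemma f0_contract (w : R[i]) : Normc.normc w <= 1 ->
  Normc.normc (2 * w + w ^+ 2) <= 3 * Normc.normc w.
Proof.
move=> w1; rewrite -[2 * w + w ^+ 2]/(2 * w + w * w) -mulrDl Normc.normcM.
rewrite ler_wpM2r ?normc_ge0//; apply: le_trans (normcD_le _ _) _.
by rewrite (@normc_nat R 2); lra.
Qed.

Lemma f1_contract (w : R[i]) : Normc.normc w <= 1 / 4 -> w != -1 /\
  Normc.normc (lam * (w / (w + 1) ^+ 2)) <= 3 * Normc.normc w.
Proof.
move=> w4; split.
  by apply: contraTneq w4 => ->; rewrite normcN_eq Normc.normc1 -ltNge; lra.
have := normcD_ge 1 w; rewrite addrC Normc.normc1 !Normc.normcM Normc.normcV normcX.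
rewrite [1 + w]addrC; have := normc_ge0 w; have := normc_ge0 lam.
move: lam_lt1 w4; move: (Normc.normc lam) (Normc.normc w) (Normc.normc (w + 1)).
move=> l t d l1 t4 l0 t0 td; have d34 : 3 / 4 <= d by lra.
apply: (@le_trans _ _ (1 * (t / d ^+ 2))).
  by rewrite ler_wpM2r ?(ltW l1)// divr_ge0// exprn_ge0//; lra.
have d0 : 0 < d by lra.
have d2 : 1 / 3 <= d ^+ 2 by rewrite expr2; nra.
by rewrite mul1r ler_pdivrMr ?exprn_gt0//; nra.
Qed.

Lemma near0_le k (w : R[i]) : near0 k (Some w) -> Normc.normc w < r / 3 ^+ k.
Proof. by case=> w' /= ? [<-]. Qed.

Lemma near0_step k b z : near0 k.+1 z -> near0 k (ifs_map lam b z).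
Proof.
case=> w /= wr <-.
have {}wr : 3 * Normc.normc w < r / 3 ^+ k.
  by move: wr; rewrite exprS invfM mulrCA ltr_pdivlMl.
have w4 : Normc.normc w <= 1 / 4.
  have : r / 3 ^+ k <= r.
    by rewrite ler_pdivrMr ?exprn_gt0// ler_peMr ?(ltW r_gt0)// exprn_ege1//; lra.
  have := normc_ge0 w; move: r_le wr; lra.
case: b; rewrite /ifs_map /=.
  have [/negPf w1 w3] := f1_contract w4.
  by rewrite /f1 w1; eexists; last reflexivity; apply: le_lt_trans w3 _.
eexists; last reflexivity; apply: le_lt_trans (f0_contract _) wr; lra.
Qed.

Lemma near_infty_jump n k z : (k < 2 ^ n)%N -> near_infty n z ->
  near0 k (ifs_map lam true z).
Proof.
have s1 : 1 <= sigma by move: sigma_ge3; lra.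
move=> kn; case: z => [w /= wn|_]; last first.
  by exists 0 => //; rewrite /mkset Normc.normc0 divr_gt0 ?exprn_gt0.
(* Since [k + 1 <= 2 ^ n], one factor [sigma] is used for [4 / r] and [k] factors for the powers of
   3. *)
have sk : 4 * 3 ^+ k / r <= sigma ^+ (2 ^ n).
  apply: (@le_trans _ _ (sigma ^+ k.+1)); last by rewrite ler_weXn2l.
  rewrite exprS mulrAC; apply: ler_pM => //.
  - by rewrite divr_ge0// ltW.
  - by apply: lerXn2r; rewrite ?nnegrE//; move: sigma_ge3; lra.
have w2 : 2 <= Normc.normc w.
  by have := exprn_ege1 (2 ^ n)%N s1; move: wn; lra.
have w1 : (w == -1) = false.
  by apply/negP => /eqP wE; move: w2; rewrite wE normcN_eq Normc.normc1; lra.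
rewrite /ifs_map /f1 w1; eexists; last reflexivity.
rewrite /=; have w0 : 0 < Normc.normc w by lra.
rewrite -(ltr_pM2r w0); apply: le_lt_trans (f1_infty_le _ w2) _.
have k0 : 0 < 3 ^+ k :> R by rewrite exprn_gt0.
rewrite mulrAC ltr_pdivlMr//; move: sk; rewrite ler_pdivrMr// => sk.
have lk : 4 * Normc.normc lam * 3 ^+ k <= 4 * 3 ^+ k.
  by rewrite ler_pM2r//; move: lam_lt1; lra.
have x0 : 0 < sigma ^+ (2 ^ n) by rewrite exprn_gt0//; move: s1; lra.
have xr : sigma ^+ (2 ^ n) * r < Normc.normc w * r.
  by rewrite ltr_pM2r//; move: wn; lra.
by move: lk sk xr; rewrite [r * _]mulrC; lra.
Qed.

Lemma near_infty_step n z : near_infty n z -> near_infty n.+1 (ifs_map lam false z).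
Proof.
case: z => [w /= wn|//]; rewrite /near_infty /outer /=.
rewrite -[2 * w + w ^+ 2]/(2 * w + w * w) -mulrDl [2 + w]addrC Normc.normcM.
have := normcD_ge w 2; rewrite (@normc_nat R 2) expnS mulnC exprM.
have s1 : 1 <= sigma by move: sigma_ge3; lra.
have : sigma <= sigma ^+ (2 ^ n).
  by rewrite -[leLHS]expr1 ler_weXn2l// expn_gt0.
move: wn; move: (sigma ^+ _) (Normc.normc w) (Normc.normc (w + 2)).
move=> x t d xt /(le_trans sigma_ge3) x3 dt.
have xd : x < d by lra.
rewrite expr2; nra.
Qed.

Lemma near_infty_near0 n k z : near_infty n z -> ~ near0 k z.
Proof.
case: z => [w /= wn|_ [//]]; move=> /near0_le wr.
have s1 : 1 <= sigma by move: sigma_ge3; lra.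
have := exprn_ege1 (2 ^ n)%N s1.
have : r / 3 ^+ k <= r.
  by rewrite ler_pdivrMr ?exprn_gt0// ler_peMr ?(ltW r_gt0)// exprn_ege1//; lra.
move: wn wr r_le; lra.
Qed.

Lemma open_near0 k : open (near0 k). Proof. exact: open_disk. Qed.

Lemma open_near_infty n : open (near_infty n). Proof. exact: open_outer. Qed.

(** * Uniqueness of the stationary measure *)

Section Uniqueness.
Variables (p0 p1 : R) (m : probability (borel (sphere R)) R).
Hypotheses (lam_nreal : complex.Im lam != 0).
Hypotheses (p0_gt : 1 / 2 < p0) (p1_gt0 : 0 < p1) (p01 : p0 + p1 = 1).
Hypothesis m_stat : stationary p0 p1 lam m.

Let p0_gt0 : 0 < p0. Proof. by move: p0_gt; lra. Qed.

Let open_ifs_map b (A : set (sphere R)) : open A -> open (ifs_map lam b @^-1` A).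
Proof.
move=> oA; apply: open_comp => // z _.
by case: b; [exact: continuous_f1|exact: continuous_f0].
Qed.

Let meas (A : set (sphere R)) : open A -> measurable (A : set (borel (sphere R))).
Proof. exact: sub_sigma_algebra. Qed.

Let mu (A : set (sphere R)) : R := fine (m A).

Let muE (A : set (sphere R)) : open A -> m A = (mu A)%:E.
Proof. by move=> oA; rewrite /mu fineK// fin_num_measure//; exact: meas. Qed.

Let mu_ge0 A : 0 <= mu A. Proof. exact: fine_ge0. Qed.

Let mu_le A B : open A -> open B -> A `<=` B -> mu A <= mu B.
Proof.
move=> oA oB AB; rewrite -lee_fin -!muE//.
by apply: le_measure; rewrite ?inE//; exact: meas.
Qed.

Let mu_stat A : open A ->
  mu A = p0 * mu (ifs_map lam false @^-1` A) + p1 * mu (ifs_map lam true @^-1` A).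
Proof.
move=> oA; apply: EFin_inj; rewrite -muE// m_stat; last exact: meas.
by rewrite EFinD !EFinM -!muE//; apply: open_ifs_map.
Qed.

(** By stationarity each of the [2 ^ n] differences between consecutive [near0 k] has mass at least
    [p1 * mu (near_infty n)], and the masses add up to at most 1. *)
Let mu_near_infty_le n : 2 ^+ n * (p1 * mu (near_infty n)) <= 1.
Proof.
have step k : (k < 2 ^ n)%N -> mu (near0 k.+1) + p1 * mu (near_infty n) <= mu (near0 k).
  move=> kn; rewrite [leRHS]mu_stat; last exact: open_near0.
  have H0 : mu (near0 k.+1) <= mu (ifs_map lam false @^-1` near0 k).
    apply: mu_le; [exact: open_near0|exact/open_ifs_map/open_near0|].
    by move=> z; exact: near0_step.
  have H1 : mu (near0 k.+1) + mu (near_infty n) <= mu (ifs_map lam true @^-1` near0 k).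
    have oU : open (near0 k.+1 `|` near_infty n).
      by apply: openU; [exact: open_near0|exact: open_near_infty].
    apply: (@le_trans _ _ (mu (near0 k.+1 `|` near_infty n))).
      rewrite -lee_fin EFinD -!muE; [|exact: oU|exact: open_near_infty|exact: open_near0].
      rewrite le_eqVlt; apply/orP; left; apply/eqP/esym.
      apply: measureU; [by apply: meas; exact: open_near0|by apply: meas; exact: open_near_infty|].
      by apply/seteqP; split=> // z [z0 /near_infty_near0/(_ z0)].
    apply: mu_le => //; first exact/open_ifs_map/open_near0.
    by move=> z [|]; [exact: near0_step|exact: near_infty_jump].
  have := ler_wpM2l (ltW p0_gt0) H0; have := ler_wpM2l (ltW p1_gt0) H1.
  have -> : p0 = 1 - p1 by rewrite -p01 addrK.
  lra.
have sum k : (k <= 2 ^ n)%N ->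
    mu (near0 k) + k%:R * (p1 * mu (near_infty n)) <= mu (near0 0).
  elim: k => [|k IH] kn; first by rewrite mul0r addr0.
  have := IH (ltnW kn); have := step k kn; rewrite -natr1; lra.
have := sum _ (leqnn _); have := mu_ge0 (near0 (2 ^ n)); rewrite natrX.
have : mu (near0 0) <= 1.
  by rewrite -lee_fin -muE ?probability_le1//; [by apply: meas; exact: open_near0|exact: open_near0].
lra.
Qed.

(** Iterating [f0] gives [mu (near_infty n) >= p0^n mu (near_infty 0)]; against the previous bound
    [(2 p0)^n] would have to stay bounded. *)
Let mu_near_infty0 : mu (near_infty 0) = 0.
Proof.
have pow n : p0 ^+ n * mu (near_infty 0) <= mu (near_infty n).
  elim: n => [|n IH]; first by rewrite expr0 mul1r.
  rewrite exprS -mulrA [leRHS]mu_stat; last exact: open_near_infty.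
  apply: ler_wpDr; first by rewrite mulr_ge0// ltW.
  rewrite ler_pM2l//; apply: le_trans IH _.
  apply: mu_le; [exact: open_near_infty|exact/open_ifs_map/open_near_infty|].
  by move=> z; exact: near_infty_step.
apply/eqP; rewrite eq_le mu_ge0 andbT leNgt; apply/negP => mu0.
have [|n] := @exprn_unbounded _ (2 * p0) (p1 * mu (near_infty 0))^-1.
  by move: p0_gt; lra.
have pm : 0 < p1 * mu (near_infty 0) by rewrite mulr_gt0.
rewrite -[ltLHS]div1r ltr_pdivrMr//; apply/negP; rewrite -leNgt.
apply: le_trans (mu_near_infty_le n); rewrite exprMn -!mulrA ler_pM2l ?exprn_gt0//.
by rewrite mulrCA ler_pM2l.
Qed.

(** Stationarity writes 0 as a combination of the masses of the two preimages with positive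
    weights. *)
Let mu_word s A : open A -> mu A = 0 -> mu (word_map lam s @^-1` A) = 0.
Proof.
elim: s A => [//|b s IH] A oA A0.
have {}IH := IH A oA A0; set A' := word_map lam s @^-1` A in IH.
have oA' : open A'.
  by apply: open_comp => // z _; exact: continuous_word_map.
have := mu_stat oA'; rewrite IH.
have := mu_ge0 (ifs_map lam false @^-1` A'); have := mu_ge0 (ifs_map lam true @^-1` A').
rewrite -[X in _ -> _ -> _ -> mu X = _]/(ifs_map lam b @^-1` A').
move=> t0 f0 /esym/eqP; rewrite paddr_eq0 ?mulr_ge0 ?(ltW p0_gt0) ?(ltW p1_gt0)//.
by rewrite !mulf_eq0 (gt_eqF p0_gt0) (gt_eqF p1_gt0)/= => /andP[/eqP ? /eqP ?]; case: b.
Qed.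

Lemma stationary_null_off_near0 k : m (~` near0 k) = 0%E.
Proof.
apply: (@measure_negligible _ _ _ m).
  by apply: measurableC; by apply: meas; exact: open_near0.
have [N NP] : exists N, forall z, ~ near0 k z ->
    exists2 s, (size s <= N)%N & near_infty 0 (word_map lam s z).
  by apply: escapes_uniform => //; rewrite divr_gt0// exprn_gt0.
have : m.-negligible (\bigcup_s (word_map lam s @^-1` near_infty 0)); last first.
  by apply: negligibleS => z /NP[s _ sz]; exists s.
apply: negligible_bigcup_count => s.
have os : open (word_map lam s @^-1` near_infty 0).
  apply: open_comp; last exact: open_near_infty.
  by move=> z _; exact: continuous_word_map.
apply/negligibleP; first exact: meas.
by have := muE os; rewrite mu_word//; exact: open_near_infty.
Qed.

Lemma stationary_eq_delta0 A : measurable A -> m A = delta0 A.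
Proof.
have cover : ~` [set Some 0 : borel (sphere R)] =
    \bigcup_k ~` (near0 k : set (borel (sphere R))).
  apply/seteqP; split=> [[w w0|_]|z [k _ zk] /= z0].
  - have wn : 0 < Normc.normc w.
      by rewrite normc_gt0; apply/eqP => wE; apply: w0; rewrite /= wE.
    have [|k kP] := @exprn_unbounded _ 3 (r / Normc.normc w); first by lra.
    exists k => // /near0_le; rewrite ltr_pdivlMr ?exprn_gt0//.
    by move: kP; rewrite ltr_pdivrMr// mulrC => /lt_trans h /h; rewrite ltxx.
  - by exists 0%N => //; case.
  - apply: zk; rewrite z0; exists 0 => //; rewrite /mkset Normc.normc0.
    by rewrite divr_gt0// exprn_gt0.
have null0 : m.-negligible (~` [set Some 0 : borel (sphere R)]).
  rewrite cover; apply: negligible_bigcup => k.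
  apply/negligibleP; last exact: stationary_null_off_near0.
  by apply: measurableC; apply: meas; exact: open_near0.
move=> mA; rewrite [RHS]diracE;
have [A0|A0] := pselect (A (Some 0)).
  have : m (~` A) = 0%E.
    apply: measure_negligible; first exact: measurableC.
    by apply: negligibleS null0 => z zA /= z0; apply: zA; rewrite z0.
  rewrite mem_set// probability_setC// -(fineK (fin_num_measure m _ mA)) -EFinB.
  by move=> [/eqP]; rewrite subr_eq0 => /eqP <-.
rewrite memNset//; apply: measure_negligible => //.
by apply: negligibleS null0 => z zA /= z0; apply: A0; rewrite -z0.
Qed.

End Uniqueness.
End Geometry.

Lemma stationary_delta0 (R : realType) (lam : R[i]) (p0 p1 : R) :
  p0 + p1 = 1 -> stationary p0 p1 lam delta0.
Proof.
move=> p01 A mA.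
have fix0 (f : borel (sphere R) -> borel (sphere R)) :
    f (Some 0) = Some 0 -> (delta0 (f @^-1` A) = delta0 A :> \bar R).
  move=> f0; rewrite [LHS]diracE [RHS]diracE.
  congr ((nat_of_bool _)%:R%:E).
  by apply/idP/idP; rewrite !inE /= f0.
rewrite /pushforward !fix0.
- have -> : (delta0 A = (\1_A (Some 0 : borel (sphere R)))%:E :> \bar R) by [].
  by rewrite -!EFinM -EFinD -mulrDl p01 mul1r.
- by rewrite /f1 eq_sym oppr_eq0 oner_eq0 mul0r mulr0.
- by rewrite /f0 mulr0 expr0n addr0.
Qed.

(** * Average expansion at 0 *)

Lemma dominated_exp_moment (R : realType) (p0 p1 a b : R) :
  0 < p0 -> 0 < p1 -> p0 + p1 = 1 -> 0 < p0 * a + p1 * b ->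
  exists2 s, 0 < s & p0 * expR (- (s * a)) + p1 * expR (- (s * b)) < 1.
Proof.
move=> p00 p10 p01; set l := _ + _ => l0.
have a2 : 0 <= a ^+ 2 by exact: sqr_ge0.
have b2 : 0 <= b ^+ 2 by exact: sqr_ge0.
pose M := 1 + a ^+ 2 + b ^+ 2; have M0 : 0 < M by rewrite /M; lra.
(* At [s = 0] the moment is 1 and its derivative is [- l]. The first bound allows
   [expR_le_quadratic], because [|a|] and [|b|] are at most [M]; the second keeps the quadratic
   terms below [s l / 2]. *)
pose s := Num.min (1 / (2 * M)) (l / (4 * M)).
have s0 : 0 < s by rewrite lt_min !divr_gt0 ?mulr_gt0.
have sM : s * M <= 1 / 2.
  have : s <= 1 / (2 * M) by rewrite ge_min lexx.
  by rewrite ler_pdivlMr ?mulr_gt0//; lra.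
have sl : s * M <= l / 4.
  have : s <= l / (4 * M) by rewrite ge_min lexx orbT.
  by rewrite ler_pdivlMr ?mulr_gt0//; lra.
have bound c : c ^+ 2 <= M - 1 ->
    expR (- (s * c)) <= 1 + - (s * c) + 2 * (s * (l / 4)).
  move=> cM; apply: le_trans (expR_le_quadratic _) _.
    apply: le_trans sM; rewrite -mulrN ler_pM2l//.
    by move: cM; rewrite expr2; nra.
  rewrite lerD2l ler_pM2l// sqrrN exprMn expr2 -mulrA ler_pM2l//.
  by apply: le_trans sl; rewrite ler_pM2l//; move: cM; lra.
exists s => //.
have Ha : a ^+ 2 <= M - 1 by rewrite /M; lra.
have Hb : b ^+ 2 <= M - 1 by rewrite /M; lra.
have := lerD (ler_wpM2l (ltW p00) (bound _ Ha)) (ler_wpM2l (ltW p10) (bound _ Hb)).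
move=> /le_lt_trans; apply.
have sl0 : 0 < s * l by rewrite mulr_gt0.
have pE : p1 = 1 - p0 by rewrite -p01 addrAC subrr add0r.
by move: sl0; rewrite /l pE; lra.
Qed.

Section Lyapunov.
Context {R : realType}.
Variables (lam : R[i]) (p0 p1 : R).
Hypotheses (lam_neq0 : lam != 0) (p0_gt0 : 0 < p0) (p1_gt0 : 0 < p1).
Hypotheses (p01 : p0 + p1 = 1).
Hypothesis lyapunov : 0 < p0 * ln 2 + p1 * ln (Normc.normc lam).

(* [|z| ^ (- s)], with value [0] at infinity. *)
Definition inv_pow (s : R) (z : sphere R) : R :=
  if z is Some w then expR (- (s * ln (Normc.normc w))) else 0.

Lemma inv_pow_drift : exists r s rho : R,
  [/\ 0 < r <= 1 / 4, 0 < s, 0 <= rho < 1 & forall w,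
    w != 0 -> Normc.normc w < r ->
    avg p0 p1 (ifs_map lam) (inv_pow s) (Some w) <= rho * inv_pow s (Some w)].
Proof.
pose l := p0 * ln 2 + p1 * ln (Normc.normc lam).
pose r := Num.min (1 / 4) (l / 4).
have l0 : 0 < l by [].
have r0 : 0 < r by rewrite lt_min !divr_gt0.
have r4 : r <= 1 / 4 by rewrite ge_min lexx.
have rl : r <= l / 4 by rewrite ge_min lexx orbT.
pose a := ln 2 - r; pose b := ln (Normc.normc lam) - 2 * r.
have [||||s s0 sP] := @dominated_exp_moment R p0 p1 a b => //.
  have -> : p0 * a + p1 * b = l - (p0 + p1 * 2) * r by rewrite /a /b /l; ring.
  have : p1 < 1 by rewrite -p01 ltrDr.
  by move: r0 rl l0 p01; nra.
exists r, s, (p0 * expR (- (s * a)) + p1 * expR (- (s * b))); split=> //.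
- by rewrite r0.
- by rewrite sP andbT addr_ge0// mulr_ge0 ?expR_ge0 ?ltW.
move=> w w0 wr.
have nw : 0 < Normc.normc w by rewrite normc_gt0.
have w1 : w != -1.
  by apply: contraTneq wr => ->; rewrite normcN_eq Normc.normc1 -leNgt; lra.
have lam0 : 0 < Normc.normc lam by rewrite normc_gt0.
have two_w : 2 * expR (- r) <= Normc.normc (2 + w).
  have H := normcD_ge 2 w; rewrite (@normc_nat R 2) in H.
  (* By [exp (- r) <= 1 / (1 + r)] and [r <= 1]. *)
  have H2 : expR (- r) <= 1 - r / 2.
    rewrite expRN -[leLHS]div1r ler_pdivrMr ?expR_gt0//.
    have := expR_ge1Dx r; nra.
  lra.
have one_w : Normc.normc (w + 1) <= expR r.
  have := normcD_le w 1; rewrite Normc.normc1; have := expR_ge1Dx r; lra.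
have w10 : 0 < Normc.normc (w + 1) by rewrite normc_gt0 addr_eq0.
have w20 : 0 < Normc.normc (2 + w) by apply: lt_le_trans two_w; rewrite mulr_gt0 ?expR_gt0.
have f0E : inv_pow s (ifs_map lam false (Some w)) <=
    expR (- (s * a)) * inv_pow s (Some w).
  rewrite /= -[2 * w + w ^+ 2]/(2 * w + w * w) -mulrDl Normc.normcM.
  rewrite lnM ?posrE// -expRD ler_expR -opprD lerN2 -mulrDr ler_pM2l// lerD2r.
  rewrite /a -(expRK (- r)) -lnM ?posrE ?expR_gt0//.
  by rewrite ler_ln ?posrE// mulr_gt0 ?expR_gt0.
have f1E : inv_pow s (ifs_map lam true (Some w)) <=
    expR (- (s * b)) * inv_pow s (Some w).
  rewrite /ifs_map /f1 (negPf w1) /inv_pow !Normc.normcM Normc.normcV normcX.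
  rewrite !lnM ?posrE ?divr_gt0 ?invr_gt0 ?exprn_gt0// lnV ?posrE ?exprn_gt0//.
  rewrite lnXn// -expRD ler_expR -opprD lerN2 -mulrDr ler_pM2l// /b.
  have : ln (Normc.normc (w + 1)) <= r by rewrite -[leRHS]expRK ler_ln ?posrE ?expR_gt0.
  rewrite mulr2n; lra.
rewrite /avg mulrDl -!mulrA; apply: lerD.
  by rewrite ler_pM2l.
by rewrite ler_pM2l.
Qed.
End Lyapunov.

(** * Almost sure statements *)

Section ExceptionalSet.
Context {R : realType}.
Variable lam : R[i].
Hypothesis lam_neq0 : lam != 0.

Definition hits_zero : set (sphere R) := [set z | exists s, word_map lam s z = Some 0].

Lemma ifs_map_fiber b (y : sphere R) : finite_set (ifs_map lam b @^-1` [set y]).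
Proof.
have fin (s : seq (sphere R)) : (ifs_map lam b @^-1` [set y] `<=` [set` s]) ->
    finite_set (ifs_map lam b @^-1` [set y]).
  by move=> /sub_finite_set; apply; exact: finite_seq.
(* Either the fiber has a finite point with finite image, from which the others are computed, or its
   only possible finite point is the pole [-1]. *)
have [[w [z]]|none] := pselect (exists w, ifs_map lam b (Some w) = y /\ y <> None);
    last first.
  apply: (fin [:: None; Some (-1)]) => -[w zy|_]; rewrite /= !inE ?eqxx//.
  apply/orP; right; apply/eqP; congr Some; apply: contrapT => wN1.
  apply: none; exists w; split => //; rewrite -zy /ifs_map; case: b {fin zy} => //.
  by rewrite /f1; case: eqVneq.
case: b fin z => fin; rewrite /ifs_map.
  rewrite /f1; case: eqVneq => [_ <-//|w1 yE _].
  set c := lam * _ in yE.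
  (* The equation in [w'] is quadratic with sum of roots [lam / c - 2]; for [c = 0] its only
     solution is [w]. *)
  apply: (fin [:: None; Some w; Some (lam / c - 2 - w)]) => -[w'|_] /=; last by rewrite inE.
  rewrite /f1; case: eqVneq => [_|w'1]; rewrite -yE//; move=> [cE].
  have e1 : lam * w = c * (w + 1) ^+ 2.
    by rewrite /c; field; rewrite addr_eq0.
  have e2 : lam * w' = c * (w' + 1) ^+ 2.
    by rewrite -cE; field; rewrite addr_eq0.
  rewrite !inE; have [->|ww] := eqVneq w' w; first by rewrite eqxx.
  have c0 : c != 0.
    apply: contra ww => /eqP c0; move: e1 e2; rewrite c0 !mul0r => <- /(mulfI lam_neq0) ->.
    by [].
  apply/orP; right; apply/orP; right; apply/eqP; congr Some.
  have d0 : w' - w != 0 by rewrite subr_eq0.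
  apply: (mulfI c0); apply: (mulfI d0).
  transitivity ((w' - w) * (lam - 2 * c - w * c) +
     ((c * (w' + 1) ^+ 2 - lam * w') - (c * (w + 1) ^+ 2 - lam * w))); first by ring.
  by rewrite e1 e2 !subrr addr0; field.
rewrite /f0 => yE _; rewrite -yE in fin *.
apply: (fin [:: None; Some w; Some (- 2 - w)]) => -[w'|//] /= [E].
have : (w' - w) * (w' - (- 2 - w)) = 0.
  transitivity ((2 * w' + w' ^+ 2) - (2 * w + w ^+ 2)); first by ring.
  by rewrite E subrr.
by move/eqP; rewrite mulf_eq0 !subr_eq0 !inE => /orP[/eqP ->|/eqP ->]; rewrite eqxx ?orbT.
Qed.

Lemma word_map_fiber s : finite_set (word_map lam s @^-1` [set Some 0]).
Proof.
elim: s => [|b s IH].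
  by rewrite (_ : _ @^-1` _ = [set Some 0])//; exact: finite_set1.
rewrite (_ : _ @^-1` _ = \bigcup_(y in word_map lam s @^-1` [set Some 0])
    (ifs_map lam b @^-1` [set y])).
  by apply: bigcup_finite => // y _; exact: ifs_map_fiber.
apply/seteqP; split=> [z /= zs|z [y /= ys zy]]; first by exists (ifs_map lam b z).
by rewrite -[LHS]/(word_map lam s (ifs_map lam b z)) zy.
Qed.

Lemma measurable_hits_zero : measurable (hits_zero : set (borel (sphere R))).
Proof.
(* [outer 0] is the complement of the origin, so this is a countable union of closed sets. *)
rewrite (_ : hits_zero = \bigcup_s ~` (word_map lam s @^-1` outer 0)).
  apply: countable_bigcupT_measurable => // s; apply: measurableC.
  apply: sub_sigma_algebra; apply: open_comp; last exact: open_outer.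
  by move=> z _; exact: continuous_word_map.
have E (z : sphere R) : z = Some 0 <-> ~ outer 0 z.
  case: z => [w|] /=; last by split=> // /(_ I).
  rewrite normc_gt0; split=> [[->]|/negP]; first by rewrite eqxx.
  by rewrite negbK => /eqP ->.
by apply/seteqP; split=> [z [s /E zs]|z [s _ /E zs]]; exists s.
Qed.

Lemma sphere_area_countable (A : set (borel (sphere R))) :
  countable [set v : R * R | A (Some (v.1 +i* v.2))] -> sphere_area A = 0%E.
Proof.
move=> cA; have meas (B : set (R * R)) : countable B -> measurable B.
  apply: countable_measurable => -[x y].
  rewrite (_ : [set _] = [set x] `*` [set y]); last first.
    by apply/seteqP; split=> [_ ->|[? ?] [/= -> ->]].
  by apply: measurableX; exact: measurable_set1.
rewrite /sphere_area; apply: null_set_integral; first exact: meas.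
  move=> _ B _; apply: meas; apply: sub_countable cA.
  by apply: subset_card_le => v [].
(* The product measure integrates the measures of the sections, which are countable. *)
apply: integral0_eq => x _ /=.
apply: countable_lebesgue_measure0.
apply: sub_countable (sub_countable (card_image_le snd _) cA).
by apply: subset_card_le => y; rewrite /xsection /= inE => Ay; exists (x, y).
Qed.

Lemma sphere_area_hits_zero : sphere_area hits_zero = 0%E.
Proof.
apply: sphere_area_countable.
pose h (z : sphere R) := if z is Some (x +i* y) then (x, y) else (0, 0).
apply: (@sub_countable _ _ _ (\bigcup_s (h @` (word_map lam s @^-1` [set Some 0])))).
  by apply: subset_card_le => -[x y] [s sz]; exists s => //; exists (Some (x +i* y)).
apply: bigcup_countable => // s _.
exact/finite_set_countable/finite_image/word_map_fiber.
Qed.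
End ExceptionalSet.

Section AlmostSure.
Context {R : realType}.
Local Notation Omega := (borel cantor_space).
Variables (lam : R[i]) (p0 p1 : R) (nu : probability Omega R).
Hypotheses (nuB : is_bernoulli p0 p1 nu).
Implicit Types (A D : set (sphere R)) (z : sphere R).

Local Notation run := (run (ifs_map lam)).

Lemma run_orbit (w : nat -> bool) k n z : (k <= n)%N ->
  run (take k (mkseq w n)) z = ifs_orbit lam w k z.
Proof.
move=> kn; rewrite ifs_orbitE; congr (word_map _ _ _).
by rewrite /mkseq -map_take take_iota; congr (map _ (iota _ _)); apply/minn_idPl.
Qed.

Lemma visits_orbit A (w : nat -> bool) n z :
  visits (ifs_map lam) A (mkseq w n) z = (\sum_(k < n) (ifs_orbit lam w k z \in A))%N.
Proof.
rewrite /visits -(big_mkord xpredT (fun k => nat_of_bool (run (take k (mkseq w n)) z \in A))).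
rewrite size_mkseq big_mkord; apply: eq_bigr => k _.
by rewrite run_orbit// ltnW.
Qed.

Lemma negligible_bigcap_small (F : nat -> set Omega) :
  (forall n, measurable (F n)) ->
  (forall e : R, 0 < e -> exists n, (nu (F n) <= e%:E)%E) ->
  nu.-negligible (\bigcap_n F n).
Proof.
move=> mF small; have mI : measurable (\bigcap_n F n) by exact: bigcap_measurableType.
apply/negligibleP => //; apply/eqP; rewrite eq_le measure_ge0 andbT.
apply/lee_addgt0Pr => e e0; rewrite add0e; have [n nP] := small e e0.
apply: le_trans nP; apply: le_measure; rewrite ?inE//.
by move=> w /(_ n I).
Qed.

(** If [A] is visited finitely often, [D] is avoided from some time [M] on; for fixed [M] this event
    lies in events of arbitrarily small measure. *)
Lemma negligible_finitely_often D A z :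
  (forall M e, 0 < e -> exists n, expect p0 p1 (M + n)
     (fun s => (avoids (ifs_map lam) D (drop M s) (run (take M s) z))%:R) < e) ->
  D `<=` A ->
  nu.-negligible [set w | finite_set [set n | A (ifs_orbit lam w n z)]].
Proof.
move=> van DA.
pose F M n := [set w : Omega |
  avoids (ifs_map lam) D (drop M (mkseq w (M + n))) (run (take M (mkseq w (M + n))) z)].
have : nu.-negligible (\bigcup_M \bigcap_n F M n).
  apply: negligible_bigcup => M; apply: negligible_bigcap_small => [n|e e0].
    exact: (measurable_word 0 (M + n)
      (fun s => avoids (ifs_map lam) D (drop M s) (run (take M s) z))).
  have [n nP] := van M e e0; exists n.
  rewrite /F (bernoulli_word nuB (M + n)
    (fun s => avoids (ifs_map lam) D (drop M s) (run (take M s) z))).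
  by rewrite lee_fin ltW.
apply: negligibleS => w /= /finite_seqP[s sE].
(* The sum of the visit times plus one exceeds each of them. *)
exists (\sum_(k <- s) k).+1%N => // n _; apply/avoidsP => k kn Dk.
set M := (\sum_(k <- s) k).+1%N in kn Dk.
have kMn : (M + k <= M + n)%N.
  by move: kn; rewrite size_drop size_mkseq addKn leq_add2l.
have : A (ifs_orbit lam w (M + k) z).
  apply: DA; rewrite -(run_orbit w z kMn); move: Dk.
  by rewrite /run -foldl_cat takeD.
rewrite -[A _]/([set n | A (ifs_orbit lam w n z)] (M + k)%N) sE /= => Ms.
have : (M + k <= \sum_(k <- s) k)%N by rewrite (big_rem _ Ms)/= leq_addr.
by rewrite /M addSn ltnNge leq_addr.
Qed.

(** Borel-Cantelli: the measures have sum at most [C / (1 - t)]. *)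
Lemma negligible_frequency A (C t d : R) z : 0 <= C -> 0 <= t < 1 ->
  (forall n, expect p0 p1 n
     (fun s => (d * n%:R <= (visits (ifs_map lam) A s z)%:R)%R%:R) <= C * t ^+ n) ->
  nu.-negligible (lim_sup_set (fun n =>
    [set w : Omega | d * n%:R <= (\sum_(k < n) (ifs_orbit lam w k z \in A))%:R])).
Proof.
move=> C0 /andP[t0 t1] dev; set F := (F in lim_sup_set F).
have FE n : F n = [set w : Omega |
    d * n%:R <= (visits (ifs_map lam) A (mkseq w n) z)%:R].
  by apply/seteqP; split=> w; rewrite /F /= visits_orbit.
have mF n : measurable (F n).
  rewrite FE; exact: (measurable_word 0 n
    (fun s => d * n%:R <= (visits (ifs_map lam) A s z)%:R)).
have nuF n : (nu (F n) <= (C * t ^+ n)%:E)%E.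
  rewrite FE (bernoulli_word nuB n
    (fun s => d * n%:R <= (visits (ifs_map lam) A s z)%:R)).
  by rewrite lee_fin dev.
apply/negligibleP.
  apply: bigcap_measurableType => n _; apply: bigcup_measurable => k _; exact: mF.
apply: lim_sup_set_cvg0 => //.
apply: (@le_lt_trans _ _ (C / (1 - t))%:E); last by rewrite ltry.
apply: lime_le; first by apply: is_cvg_nneseries => n _ _; exact: measure_ge0.
apply: nearW => n; apply: (@le_trans _ _ (\sum_(0 <= k < n) (C * t ^+ k)%:E)%E).
  by apply: lee_sum => k _; exact: nuF.
rewrite sumEFin lee_fin -mulr_sumr ler_wpM2l//.
have t10 : 0 < 1 - t by rewrite subr_gt0.
rewrite -[leRHS]div1r ler_pdivlMr// mulrC.
have -> : (1 - t) * \sum_(0 <= k < n) t ^+ k = 1 - t ^+ n.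
  by rewrite big_mkord -[1 - t]opprB mulNr -subrX1 opprB.
by rewrite lerBlDr lerDl exprn_ge0.
Qed.

Lemma card_visits (A B : set (sphere R)) (w : nat -> bool) N z : ~` B `<=` A ->
  (N <= #|[pred n : 'I_N | ifs_orbit lam w n z \in B]| +
   \sum_(k < N) (ifs_orbit lam w k z \in A))%N.
Proof.
move=> BA; rewrite -sum1_card big_mkcond -big_split/= -[leqLHS]card_ord -sum1_card.
apply: leq_sum => k _; rewrite !inE; case: ifPn => // /negP nB.
by rewrite mem_set//; apply: BA => /mem_set.
Qed.

Lemma frequency_cvg (A B : set (sphere R)) (w : nat -> bool) z : ~` B `<=` A ->
  (forall d : R, 0 < d -> exists M, forall n, (M <= n)%N ->
     (\sum_(k < n) (ifs_orbit lam w k z \in A))%:R < d * n%:R) ->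
  (#|[pred n : 'I_N | ifs_orbit lam w n z \in B]|%:R / N%:R : R)
    @[N --> \oo] --> (1 : R).
Proof.
move=> BA H; apply/cvgrPdist_lt => e e0; have [M MP] := H e e0.
exists M.+1 => // n /= Mn; have n0 : 0 < n%:R :> R by rewrite ltr0n (leq_trans _ Mn).
have := card_visits w n z BA; have := MP n (ltnW Mn).
set a := #|_|; set v := (\sum_(_ < _) _)%N => vn.
rewrite -(ler_nat R) natrD => av.
have an : a%:R <= n%:R :> R.
  by rewrite ler_nat; apply: leq_trans (max_card _) _; rewrite card_ord.
have -> : 1 - a%:R / n%:R = (n%:R - a%:R) / n%:R :> R by field; rewrite gt_eqF.
rewrite ger0_norm; last by rewrite divr_ge0 ?(ltW n0)// subr_ge0.
by rewrite ltr_pdivrMr//; move: vn av; lra.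
Qed.
End AlmostSure.

Theorem theorem3p6 (R : realType) (lam : R[i]) (p0 p1 : R)
    (lam_lt1 : Normc.normc lam < 1) (lam_nonreal : complex.Im lam != 0)
    (p0_01 : 0 < p0 < 1) (p1_01 : 0 < p1 < 1) (p0p1 : p0 + p1 = 1)
    (lyapunov : 0 < p0 * ln 2 + p1 * ln (Normc.normc lam))
    (p0_gt : 1 / 2 < p0) :
  (stationary p0 p1 lam delta0 /\
   (forall m : probability (borel (sphere R)) R, stationary p0 p1 lam m ->
      forall A : set (borel (sphere R)), measurable A -> m A = delta0 A)) /\
  (forall nu : probability (borel cantor_space) R, is_bernoulli p0 p1 nu ->
   forall eps : R, 0 < eps ->
   {ae sphere_area, forall z : sphere R, {ae nu, forall w : cantor_space,
      infinite_set [set n | ~ disk eps (ifs_orbit lam w n z)] /\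
      (#|[pred n : 'I_N | ifs_orbit lam w n z \in disk eps]|%:R / N%:R : R)
        @[N --> \oo] --> (1 : R)}}).
Proof.
have /andP[p00 _] := p0_01; have /andP[p10 _] := p1_01.
have lam0 := nonreal_neq0 lam_nonreal.
split.
  split; first exact: stationary_delta0.
  move=> m mst A mA.
  (* The scales used are [r = 1 / 4] and [sigma = 4 / r = 16]. *)
  have q0 : 0 < 1 / 4 :> R by lra.
  have q4 : 4 / (1 / 4) <= 16 :> R by lra.
  have q3 : 3 <= 16 :> R by lra.
  exact: (stationary_eq_delta0 lam_lt1 lam0 q0 (lexx _) q3 q4 lam_nonreal p0_gt p10 p0p1 mst mA).
move=> nu nuB eps eps0.
have [r0 [s [rho [/andP[r00 r04] s0 rho01 Vstep]]]] := inv_pow_drift lam0 p00 p10 p0p1 lyapunov.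
pose r := Num.min r0 eps.
have r_gt0 : 0 < r by rewrite lt_min r00.
have r_r0 : r <= r0 by rewrite ge_min lexx.
have r_eps : r <= eps by rewrite ge_min lexx orbT.
have r4 : r <= 1 / 4 := le_trans r_r0 r04.
(* Being at least [eps], [sigma] also makes [near_infty sigma 0] disjoint from [disk eps], so that
   visits near infinity count for (1). *)
pose sigma := Num.max (Num.max 3 (4 / r)) eps.
have sigma3 : 3 <= sigma by rewrite !le_max lexx.
have sigma4 : 4 / r <= sigma by rewrite !le_max lexx orbT.
have sigma_eps : eps <= sigma by rewrite le_max lexx orbT.
have [N reach] : exists N, forall z, ~ near0 r 0 z ->
    exists2 s, (size s <= N)%N & near_infty sigma 0 (word_map lam s z).
  by apply: escapes_uniform => //; rewrite divr_gt0// exprn_gt0.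
have near_eps : near0 r 0 `<=` disk eps.
  by move=> _ [w /= wr <-]; exists w => //=; move: wr; rewrite expr0 divr1 => /lt_le_trans; exact.
have infty_eps : near_infty sigma 0 `<=` ~` disk eps.
  move=> _ /[swap] -[w /= we <-] /=; rewrite expr1; lra.
exists (hits_zero lam); split; first exact: measurable_hits_zero.
  exact: sphere_area_hits_zero.
move=> z; apply: contra_notP => Xz.
(* The frequency threshold [1 / (j + 1)], written as [3 delta] to fit [visits_deviation]. *)
pose F j n := [set w : borel cantor_space | 3 * (j.+1%:R^-1 / 3) * n%:R <=
  (\sum_(k < n) (ifs_orbit lam w k z \in ~` near0 r 0))%:R :> R].
(* Part (1): off [hits_zero], which is stable under both maps, [inv_pow s] serves as the function
   [V] of the hitting argument. *)
have neg1 : nu.-negligible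
    [set w | finite_set [set n | (~` disk eps) (ifs_orbit lam w n z)]].
  apply: (negligible_finitely_often nuB _ infty_eps) => M e e0.
  apply: (@avoids_vanish_from _ _ p0 p1 (ifs_map lam) p00 p10 p0p1
    (near0 r 0) (near_infty sigma 0) (~` hits_zero lam) (inv_pow s) rho N) => //.
  - by move=> b y Xy [t ty]; apply: Xy; exists (b :: t).
  - by case=> [w|] //=; exact: expR_ge0.
  - move=> _ _ [w /= wr <-] /=; rewrite -expR0 ler_expR -mulrN mulr_ge0 ?(ltW s0)//.
    rewrite oppr_ge0 ln_le0//; apply: ltW; apply: lt_trans wr _.
    by rewrite expr0 divr1; move: r4; lra.
  - move=> y Xy [w /= wr wy]; rewrite expr0 divr1 in wr; rewrite -wy in Xy *.
    apply: Vstep (lt_le_trans wr r_r0); apply/eqP => w0.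
    by apply: Xy; exists [::]; rewrite w0.
have neg2 : nu.-negligible (\bigcup_j lim_sup_set (F j)).
  apply: negligible_bigcup => j.
  have d0 : 0 < j.+1%:R^-1 / 3 :> R by rewrite divr_gt0// invr_gt0.
  have [U [bU dU]] := @drift _ _ p0 p1 (ifs_map lam) p00 p10 p0p1 (near0 r)
    (near_infty sigma) N p0_gt (near0_step lam_lt1 r_gt0 r4)
    (near_infty_jump lam_lt1 r_gt0 sigma3 sigma4) (near_infty_step lam sigma3)
    (near_infty_near0 r_gt0 r4 sigma3) reach _ d0.
  have [C [t [C0 t01 dev]]] := visits_deviation p00 p10 p0p1 d0 bU dU.
  exact: (negligible_frequency nuB C0 t01 (dev ^~ z)).
have := negligibleU neg1 neg2; apply: negligibleS => w bad.
apply: contrapT => /not_orP[inf freq]; apply: bad; split; first exact: inf.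
apply: (@frequency_cvg _ lam (~` near0 r 0)); first exact: subsetC.
move=> d dpos; pose j := Num.bound d^-1.
have jd : j.+1%:R^-1 < d.
  rewrite invf_plt ?posrE//.
  by apply: lt_trans (archi_boundP _) _; rewrite ?invr_ge0 ?(ltW dpos)// ltr_nat.
have /existsNP[M /not_implyP[_ /forall2NP MP]] : ~ lim_sup_set (F j) w.
  by move=> bad; apply: freq; exists j.
exists M => n Mn.
have [|/negP] := MP n; first by [].
rewrite -ltNge mulrCA divff// mulr1 => /lt_le_trans; apply.
by rewrite ler_wpM2r// ltW.
Qed.
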